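(* There is a randomized algorithm that, given a directed graph $G$ (with a set $V^\infty(G)$ of undeletable vertices), a set $T\subseteq V(G)$ and an integer $k$, runs in time $O^*(4^k)$ and produces a random set $Z\subseteq V(G)\setminus T$ such that the following holds. Let $W$ be a thin set with $|W|\le k$, and let $Y$ be a set of vertices such that for every $v\in Y$ there is an important $v-T$ separator $W'\subseteq W$. For every such pair $(W,Y)$, the probability that both $W\cap Z=\emptyset$ and $Y\subseteq Z$ hold is at least $2^{-2^{O(k)}}$.
   Context: $O^*(\cdot)$ hides polynomial factors in the input size. $G$ has a (possibly empty) set $V^\infty(G)$ of undeletable vertices. For disjoint nonempty $A,B\subseteq V(G)$, a set $W\subseteq V(G)\setminus(A\cup B\cup V^\infty(G))$ is an $A-B$ separator if $G\setminus W$ has no path from $A$ to $B$; it is minimal if no proper subset is an $A-B$ separator. We write $v-T$ for $\{v\}-T$. For a digraph $H$ and $A\subseteq V(H)$, $R^+_H(A)$ is the set of vertices reachable from $A$ in $H$. A minimal $A-B$ separator $W$ is an important $A-B$ separator if there is no $A-B$ separator $W'$ with $|W'|\le|W|$ and $R^+_{G\setminus W}(A)\subsetneq R^+_{G\setminus W'}(A)$. The reverse shadow of a set $W\subseteq V(G)\setminus V^\infty(G)$ (with respect to $T$) is the set of vertices $v$ such that $W$ is a $v-T$ separator. A set $W$ is thin if no $v\in W$ belongs to the reverse shadow of $W\setminus\{v\}$ with respect to $T$.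
   Formalization: The thin set W is additionally required to be disjoint from T and from the undeletable vertices; if W may meet T, every such W can be vacuously thin and the claimed probability bound fails (e.g. u_1,…,u_n → a → t, T={t}, W={u_j,a,t}). *)

(* Defs.v *)
From mathcomp Require Import all_boot all_order all_algebra.

Set Implicit Arguments.
Unset Strict Implicit.
Unset Printing Implicit Defensive.

(* The vertices of [W] become isolated instead of disappearing; [reach]
   therefore starts from [A :\: W]. *)
Definition del_vertices (V : finType) (e : rel V) (W : {set V}) : rel V :=
  [rel x y | [&& x \notin W, y \notin W & e x y]].

Definition reach (V : finType) (e : rel V) (W A : {set V}) : {set V} :=
  [set y | [exists x in A :\: W, connect (del_vertices e W) x y]].

Definition separator (V : finType) (e : rel V) (Vinf A B W : {set V}) : bool :=
  [&& A != set0, B != set0, [disjoint A & B],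
      W \subset ~: (A :|: B :|: Vinf) & [disjoint reach e W A & B]].

Definition minimal_separator (V : finType) (e : rel V) (Vinf A B W : {set V})
    : bool :=
  minset (separator e Vinf A B) W.

Definition important_separator (V : finType) (e : rel V)
    (Vinf A B W : {set V}) : bool :=
  minimal_separator e Vinf A B W &&
  ~~ [exists W' : {set V}, [&& separator e Vinf A B W', #|W'| <= #|W|
                             & reach e W A \proper reach e W' A]].

Definition reverse_shadow (V : finType) (e : rel V) (Vinf T W : {set V})
    : {set V} :=
  [set v | separator e Vinf [set v] T W].

Definition thin (V : finType) (e : rel V) (Vinf T W : {set V}) : Prop :=
  forall v, v \in W -> v \notin reverse_shadow e Vinf T (W :\ v).

(* First-order recursive programs over binary trees (pure
   first-order Lisp) with a fair coin. Every construct is charged one unit of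
   time. Trees are never copied or compared, and environments have length
   bounded by the program text, so each unit is a constant number of pointer
   operations on a RAM. *)

Inductive tree := Leaf | Node of tree & tree.

Fixpoint tree_size (x : tree) : nat :=
  if x is Node l r then (tree_size l + tree_size r).+1 else 1.

Inductive expr :=
| Var of nat                   (* de Bruijn index *)
| Nil
| Cons of expr & expr
| Case of expr & expr & expr   (* the last branch binds left, then right subtree
                                  as variables 0 and 1 *)
| Let of expr & expr
| Call of nat & expr
| Flip.

(* Bodies of mutually recursive unary functions; the argument is variable 0,
   and function 0 is the entry point. *)
Definition program := seq expr.

Definition body (P : program) (f : nat) : expr := nth Nil P f.

Definition enc_bool (b : bool) : tree := if b then Node Leaf Leaf else Leaf.

(* [eval P env a w t x w']: in environment [env] and with random bits [w] still
   to be read, [a] evaluates to [x] in time [t], leaving the bits [w']. There is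
   no rule for [Flip] on an exhausted supply. *)
Inductive eval (P : program) :
  seq tree -> expr -> seq bool -> nat -> tree -> seq bool -> Prop :=
| EvVar env i w : eval P env (Var i) w 1 (nth Leaf env i) w
| EvNil env w : eval P env Nil w 1 Leaf w
| EvCons env a b w1 w2 w3 s t x y :
    eval P env a w1 s x w2 -> eval P env b w2 t y w3 ->
    eval P env (Cons a b) w1 (s + t).+1 (Node x y) w3
| EvCaseLeaf env a b c w1 w2 w3 s t y :
    eval P env a w1 s Leaf w2 -> eval P env b w2 t y w3 ->
    eval P env (Case a b c) w1 (s + t).+1 y w3
| EvCaseNode env a b c w1 w2 w3 s t l r y :
    eval P env a w1 s (Node l r) w2 -> eval P [:: l, r & env] c w2 t y w3 ->
    eval P env (Case a b c) w1 (s + t).+1 y w3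
| EvLet env a b w1 w2 w3 s t x y :
    eval P env a w1 s x w2 -> eval P (x :: env) b w2 t y w3 ->
    eval P env (Let a b) w1 (s + t).+1 y w3
| EvCall env f a w1 w2 w3 s t x y :
    eval P env a w1 s x w2 -> eval P [:: x] (body P f) w2 t y w3 ->
    eval P env (Call f a) w1 (s + t).+1 y w3
| EvFlip env b w : eval P env Flip (b :: w) 1 (enc_bool b) w.

Lemma eval_det P env a w t x w' t' x' w'' :
  eval P env a w t x w' -> eval P env a w t' x' w'' ->
  [/\ t = t', x = x' & w' = w''].
Proof.
move=> H; elim: H t' x' w'' => {env a w t x w'}.
- by move=> env i w t' x' w'' H; inversion H.
- by move=> env w t' x' w'' H; inversion H.
- move=> env a b w1 w2 w3 s t x y _ IHa _ IHb t' x' w'' H.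
  inversion H; subst.
  by have [? ? ?] := IHa _ _ _ H3; subst; have [? ? ?] := IHb _ _ _ H8; subst.
- move=> env a b c w1 w2 w3 s t y _ IHa _ IHb t' x' w'' H.
  inversion H; subst; have [? // ? ?] := IHa _ _ _ H8; subst.
  by have [? ? ?] := IHb _ _ _ H9; subst.
- move=> env a b c w1 w2 w3 s t l r y _ IHa _ IHb t' x' w'' H.
  inversion H; subst; have [? // [] ? ? ?] := IHa _ _ _ H8; subst.
  by have [? ? ?] := IHb _ _ _ H9; subst.
- move=> env a b w1 w2 w3 s t x y _ IHa _ IHb t' x' w'' H.
  inversion H; subst.
  by have [? ? ?] := IHa _ _ _ H3; subst; have [? ? ?] := IHb _ _ _ H8; subst.
- move=> env f a w1 w2 w3 s t x y _ IHa _ IHb t' x' w'' H.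
  inversion H; subst.
  by have [? ? ?] := IHa _ _ _ H3; subst; have [? ? ?] := IHb _ _ _ H8; subst.
- by move=> env b w t' x' w'' H; inversion H.
Qed.

Definition outputs_within (P : program) (x : tree) (w : seq bool) (m : nat)
    (y : tree) : Prop :=
  exists t w', t <= m /\ eval P [:: x] (body P 0) w t y w'.

(* A run of time at most [m] reads at most [m] bits, so its output distribution
   is that of the uniform tape of length [m]. *)
Definition tape_prob (m : nat) (E : {set m.-tuple bool}) : rat :=
  (#|E|%:R / 2 ^+ m)%R.

Definition enc_seq (s : seq tree) : tree := foldr Node Leaf s.

Definition enc_set (n : nat) (A : {set 'I_n}) : tree :=
  enc_seq [seq enc_bool (i \in A) | i <- enum 'I_n].

(* adjacency matrix *)
Definition enc_rel (n : nat) (e : rel 'I_n) : tree :=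
  enc_seq [seq enc_seq [seq enc_bool (e i j) | j <- enum 'I_n]
          | i <- enum 'I_n].

(* binary, least significant bit first, no leading zeros *)
Definition enc_nat (k : nat) : tree :=
  enc_seq [seq enc_bool (odd (k %/ 2 ^ i)) | i <- iota 0 (up_log 2 k.+1)].

Definition enc_input (n : nat) (e : rel 'I_n) (Vinf T : {set 'I_n}) (k : nat)
    : tree :=
  enc_seq [:: enc_rel e; enc_set Vinf; enc_set T; enc_nat k].

Definition is_O_linear (f : nat -> nat) : Prop :=
  exists c k0, forall k, k0 <= k -> f k <= c * k.

(* [C * N ^ d] with [N] the input size is the polynomial factor hidden by the
   O-star notation. *)
Definition Ostar_4k (C d N k : nat) : nat := C * N ^ d * 4 ^ k.

(* Main.v *)
Require Import Defs.
From mathcomp Require Import all_boot all_order all_algebra.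
From mathcomp Require Import zify.

(* For every vertex [v] outside [T], the branching algorithm for important
   separators, run with recursion depth [2 * minn k n], yields a family of at
   most [4 ^ k] vertex sets containing all important [v]-[T] separators of size
   at most [k].  One fair coin is flipped per distinct set [S] occurring in
   these families, and [Z] consists of the [v] whose family contains a set with
   coin [1].  Given [W] and [Y], success only requires coin [1] on the sets
   contained in [W] and coin [0] on the other sets in the families of vertices
   of [W]: at most [2 ^ k + k * 4 ^ k] coins.  These demands do not conflict,
   since a subset of [W] in the family of [w \in W] would separate [w] from
   [T], contradicting thinness.

   Vertices are split into an entry and an exit node, and cuts are counted in
   a multiset of arcs.  Reversing the arcs of a source-sink path lowers all
   source-sink cuts by one; when no path is left, the nodes that cannot reach
   the sinks form the largest minimum cut.  Branching on an arc leaving it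
   (delete the arc, or move its head to the source side) decreases twice the
   remaining size minus the minimum cut, which explains the depth. *)

Set Implicit Arguments.
Unset Strict Implicit.
Unset Printing Implicit Defensive.

(** * Minimum cuts in arc lists *)

Definition darc := (nat * nat)%type.

Definition leaves (Q : pred nat) (a : darc) : bool := Q a.1 && ~~ Q a.2.

Definition cut (Q : pred nat) (A : seq darc) : nat := count (leaves Q) A.

Definition has_bit (B : seq bool) (i : nat) : bool := nth false B i.

Definition set_bit (B : seq bool) (i : nat) : seq bool := set_nth false B i true.

Lemma has_set_bit B i j : has_bit (set_bit B i) j = (j == i) || has_bit B j.
Proof. by rewrite /has_bit /set_bit nth_set_nth /=; case: eqP. Qed.

Lemma cut_submodular Q Q' A :
  cut (predU Q Q') A + cut (predI Q Q') A <= cut Q A + cut Q' A.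
Proof.
elim: A => //= a A IH; rewrite /cut /= -!/(cut _ _) /leaves /=.
by case: (Q a.1); case: (Q a.2); case: (Q' a.1); case: (Q' a.2); move: IH => /=; lia.
Qed.

(** One step of a backward search. [B] holds the nodes already known to reach a sink, and the tail
    of the arc found is the next node to join it. *)
Fixpoint find_arc (A : seq darc) (B : seq bool) : option (darc * seq darc) :=
  if A is a :: A' then
    if has_bit B a.1 then
      if find_arc A' B is Some (b, R) then Some (b, a :: R) else None
    else if has_bit B a.2 then Some (a, A')
    else if find_arc A' B is Some (b, R) then Some (b, a :: R) else None
  else None.

Lemma find_arcP A B :
  match find_arc A B with
  | Some (a, R) => [/\ ~~ has_bit B a.1, has_bit B a.2 & perm_eq A (a :: R)]
  | None => forall a, a \in A -> has_bit B a.2 -> has_bit B a.1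
  end.
Proof.
elim: A => //= a A IH.
have skip : (has_bit B a.2 -> has_bit B a.1) ->
  match (if find_arc A B is Some (b, R) then Some (b, a :: R) else None) with
  | Some (a0, R) => [/\ ~~ has_bit B a0.1, has_bit B a0.2 & perm_eq (a :: A) (a0 :: R)]
  | None => forall a0, a0 \in a :: A -> has_bit B a0.2 -> has_bit B a0.1
  end.
  case: (find_arc A B) IH => [[b R] [h1 h2 h3]|h] ha.
    split=> //; rewrite -[b :: a :: R]/([:: b; a] ++ R).
    apply: (@perm_trans _ (a :: b :: R)); first by rewrite perm_cons.
    by rewrite -[a :: b :: R]/([:: a; b] ++ R) perm_cat2r (perm_catC [:: a] [:: b]).
  by move=> x; rewrite inE => /predU1P[->|/h].
case E1: (has_bit B a.1) skip => skip; first exact: skip.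
by case E2: (has_bit B a.2) skip => skip; [rewrite E1 E2 perm_refl | exact: skip].
Qed.

(** The backward search has fuel [k]. On success, [x] is the current end of a path from [s] whose
    arcs are already reversed. On unwinding, a removed arc with tail [x] prolongs that path and is
    reversed; every other removed arc is put back. *)
Fixpoint augment (k : nat) (A : seq darc) (B : seq bool) (s : nat)
    : seq bool + nat * seq darc :=
  if has_bit B s then inr (s, A) else
  if k is k'.+1 then
    if find_arc A B is Some (a, R) then
      match augment k' R (set_bit B a.1) s with
      | inl B' => inl B'
      | inr (x, A') =>
          if x == a.1 then inr (a.2, (a.2, a.1) :: A') else inr (x, a :: A')
      end
    else inl B
  else inl B.

(** Reversing an arc [(u, v)] changes the value of [Q] by [Q v - Q u]. Along a path from [s] to [x]
    these changes telescope to [Q x - Q s]. *)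
Lemma augment_success k A B s x A' : augment k A B s = inr (x, A') ->
  [/\ has_bit B x, size A' = size A &
      forall Q : pred nat, cut Q A' + Q s = cut Q A + Q x].
Proof.
elim: k A B x A' => [|k IH] A B x A' /=.
  by case E: (has_bit B s) => // -[<- <-].
case E: (has_bit B s); first by case=> <- <-.
have := find_arcP A B; case: (find_arc A B) => [[a R] [h1 h2 h3]|] //.
case E': augment => [B'|[y A'']] //; have [k1 k2 k3] := IH _ _ _ _ E'.
have cE Q : cut Q A = leaves Q a + cut Q R by rewrite /cut (permP h3).
have sE : size A = (size R).+1 by rewrite (perm_size h3).
case: eqP => [ya|/eqP ya] [<- <-]; split; rewrite /= ?k2 ?sE //.
- move=> Q; have := k3 Q; rewrite ya cE /cut /= -!/(cut _ _) /leaves /=.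
  by case: (Q a.1); case: (Q a.2) => /=; lia.
- by move: k1; rewrite has_set_bit (negbTE ya).
- by move=> Q; have := k3 Q; rewrite cE /cut /= -!/(cut _ _); lia.
Qed.

(** Every search step uses up an arc, so fuel [size A] suffices for [B'] to be closed under
    predecessors. The last clause is what makes [outside B'] the largest cut of value zero: a node
    joins only through an arc that [Q] would otherwise leave. *)
Lemma augment_failure k A B s B' : size A <= k -> augment k A B s = inl B' ->
  [/\ ~~ has_bit B' s, forall i, has_bit B i -> has_bit B' i,
      forall a, a \in A -> has_bit B' a.2 -> has_bit B' a.1 &
      forall Q : pred nat, cut Q A = 0 -> (forall i, has_bit B i -> ~~ Q i) ->
        forall i, has_bit B' i -> ~~ Q i].
Proof.
elim: k A B => [|k IH] A B /=.
  rewrite leqn0 size_eq0 => /eqP ->; case E: (has_bit B s) => // -[<-].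
  by rewrite E; split.
move=> szA; case E: (has_bit B s) => //.
have := find_arcP A B; case: (find_arc A B) => [[a R] [h1 h2 h3]|h]; last first.
  by case=> <-; rewrite E; split.
have szR : size R <= k by rewrite (perm_size h3) in szA.
case E': augment => [B1|[y A'']]; last by case: eqP.
case=> eB; rewrite eB in E'; have [k1 k2 k3 k4] := IH _ _ szR E'; split=> //.
- by move=> i Bi; apply: k2; rewrite has_set_bit Bi orbT.
- move=> b; rewrite (perm_mem h3) inE => /predU1P[->|bR]; last exact: k3.
  by move=> _; apply: k2; rewrite has_set_bit eqxx.
move=> Q; rewrite /cut (permP h3) /= => /eqP; rewrite addn_eq0 => /andP[q1 /eqP q2] q3.
apply: k4 => // i; rewrite has_set_bit => /predU1P[->|/q3 //].
by move: q1; rewrite /leaves (q3 _ h2) andbT eqb0.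
Qed.

(** [None] means that [c] augmentations have succeeded, so that every separating cut has value at
    least [c]. *)
Fixpoint max_flow (c : nat) (A : seq darc) (B0 : seq bool) (s : nat)
    : option (seq bool) :=
  if c is c'.+1 then
    match augment (size A) A B0 s with
    | inl B => Some B
    | inr (_, A') => max_flow c' A' B0 s
    end
  else None.

Definition separates (s : nat) (B0 : seq bool) (Q : pred nat) : Prop :=
  Q s /\ forall i, has_bit B0 i -> ~~ Q i.

Notation outside B := [pred i | ~~ has_bit B i].

(* Every augmentation lowers the value of every separating cut by exactly one,
   so the residual network has the same minimum cuts as the original one. *)
Lemma max_flow_some c A B0 s B : max_flow c A B0 s = Some B ->
  [/\ separates s B0 (outside B),
      forall Q, separates s B0 Q -> cut (outside B) A <= cut Q A &
      forall Q, separates s B0 Q -> cut Q A = cut (outside B) A ->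
        forall i, Q i -> ~~ has_bit B i].
Proof.
elim: c A => //= c IH A; case E: augment => [B1|[x A']].
  case=> <-; have [h1 h2 h3 h4] := augment_failure (leqnn _) E.
  have c0 : cut (outside B1) A = 0.
    apply/eqP; rewrite /cut -leqn0 leqNgt -has_count; apply/hasPn => a /h3.
    by rewrite /leaves /= negbK; case: (has_bit B1 a.1) => //= h; apply/negP => /h.
  split; first by split=> //= i /h2 ->.
    by rewrite c0.
  move=> Q [_ Q2]; rewrite c0 => Q3 i Qi; apply/negP => Bi.
  by have := h4 _ Q3 Q2 _ Bi; rewrite Qi.
have [h1 _ h2] := augment_success E; move/IH => [k1 k2 k3].
have step Q : separates s B0 Q -> cut Q A = (cut Q A').+1.
  by case=> q1 q2; have := h2 Q; rewrite q1 (negbTE (q2 _ h1)); lia.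
split=> // Q sQ; rewrite (step _ sQ) (step _ k1); first by rewrite ltnS k2.
by case=> /(k3 _ sQ).
Qed.

Lemma max_flow_none c A B0 s Q : separates s B0 Q -> cut Q A < c ->
  max_flow c A B0 s <> None.
Proof.
move=> [q1 q2]; elim: c A => //= c IH A; case E: augment => [B1|[x A']] // lt.
have [h1 _ h2] := augment_success E; apply: IH.
by have := h2 Q; rewrite q1 (negbTE (q2 _ h1)); lia.
Qed.

(** [D] collects the tails of the deleted arcs. The [c] parallel arcs from [s] force the head of [a]
    onto the source side of every separating cut of value below [c]. *)
Fixpoint enum_cuts (f c : nat) (A : seq darc) (B0 : seq bool) (s : nat)
    (D : seq bool) : seq (seq bool) :=
  if max_flow c A B0 s is Some B then
    if find_arc A B is Some (a, R) then
      if f is f'.+1 then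
        enum_cuts f' c R B0 s (set_bit D a.1) ++
        enum_cuts f' c (nseq c (s, a.2) ++ A) B0 s D
      else [::]
    else [:: D]
  else [::].

Lemma size_enum_cuts f c A B0 s D : size (enum_cuts f c A B0 s D) <= 2 ^ f.
Proof.
elim: f A D => [|f IH] A D /=; case: max_flow => // B; case: find_arc => [[a R]|] //.
  by rewrite size_cat expnS mul2n -addnn leq_add.
by rewrite expn_gt0.
Qed.

(* The bound on [f] decreases in both branches: deleting an arc lowers the cut
   by one and the minimum by at most one; pulling its head to the source side
   raises the minimum, since [outside B] is the largest minimum cut. *)
Lemma enum_cuts_complete f c A B0 s D Q l : separates s B0 Q ->
  (forall Q', separates s B0 Q' -> subpred Q Q' -> cut Q A <= cut Q' A) ->
  (forall Q', separates s B0 Q' -> l <= cut Q' A) ->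
  2 * cut Q A <= f + l -> cut Q A < c ->
  exists2 D', D' \in enum_cuts f c A B0 s D & exists Q',
    [/\ separates s B0 Q', subpred Q Q', cut Q' A <= cut Q A &
        forall i, has_bit D' i -> has_bit D i \/
          exists2 a, a \in A & (a.1 == i) && leaves Q' a].
Proof.
elim: f A D Q l => [|f IH] A D Q0 l sQ0 minQ0 minl le_f lt_c /=.
  case E: max_flow => [B|]; last by case: (max_flow_none sQ0 lt_c).
  have [sB mB _] := max_flow_some E.
  have := find_arcP A B; case: (find_arc A B) => [[a R] [h1 h2 h3]|h].
    (* With [f = 0] the budget reads [2 * cut Q0 A <= l <= cut Q0 A], so the minimum cut is zero and
       no arc can leave it. *)
    have : 0 < cut (outside B) A by rewrite /cut (permP h3) /= {1}/leaves /= h1 h2.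
    by have := mB _ sQ0; have := minl _ sQ0; lia.
  by exists D; rewrite ?inE //; exists Q0; split=> // i ->; left.
case E: max_flow => [B|]; last by case: (max_flow_none sQ0 lt_c).
have [sB mB maxB] := max_flow_some E.
have := find_arcP A B; case: (find_arc A B) => [[a R] [h1 h2 h3]|h]; last first.
  by exists D; rewrite ?inE //; exists Q0; split=> // i ->; left.
set M := outside B in sB mB maxB *.
(* Uncrossing: [predI Q0 M] separates as well, so by submodularity and the minimality of [M],
   adjoining [M] to [Q0] does not raise the cut. The new target [Q] contains [a.1], and the case
   distinction is on [a.2]. *)
pose Q := predU Q0 M.
have sQ : separates s B0 Q.
  split=> [|i Bi]; first by apply/orP; left; case: sQ0.
  by apply/norP; split; [apply: (proj2 sQ0) | apply: (proj2 sB)].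
have sI : separates s B0 (predI Q0 M).
  split=> [|i Bi]; first by apply/andP; split; [case: sQ0 | case: sB].
  by apply/nandP; left; apply: (proj2 sQ0).
have cQ : cut Q A = cut Q0 A.
  apply/eqP; rewrite eqn_leq minQ0 // ?andbT; last by move=> i /= ->.
  by have := cut_submodular Q0 M A; have := mB _ sI; rewrite -/Q; lia.
have minQ Q' : separates s B0 Q' -> subpred Q Q' -> cut Q A <= cut Q' A.
  move=> sQ' QQ'; rewrite cQ; apply: minQ0 => // i Qi; apply: QQ'.
  by rewrite /= Qi.
rewrite -cQ in le_f lt_c *.
have Qa1 : Q a.1 by rewrite /= h1 orbT.
have cA Q' : cut Q' A = leaves Q' a + cut Q' R by rewrite /cut (permP h3).
have le_f' : 2 * cut Q A <= f.+1 + cut M A.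
  by apply: leq_trans le_f _; rewrite leq_add2l; apply: minl.
have leM : cut M A <= cut Q A by apply: mB.
have posM : 0 < cut M A by rewrite cA /leaves /= h1 h2.
have [Qa2|Qa2] := boolP (Q a.2).
  have cN Q' : cut Q' (nseq c (s, a.2) ++ A) = (Q' s && ~~ Q' a.2) * c + cut Q' A.
    by rewrite /cut count_cat count_nseq.
  have [||||D' D'in [Q' [sQ' QQ' cQ' DQ']]] :=
    IH (nseq c (s, a.2) ++ A) D Q (cut M A).+1 sQ _ _ _ _.
  - move=> Q' sQ' QQ'; rewrite !cN Qa2 andbF.
    by apply: leq_trans (minQ _ sQ' QQ') (leq_addl _ _).
  - move=> Q' sQ'; rewrite cN (proj1 sQ') /=.
    case: (boolP (Q' a.2)) => Q'a2 /=; last by rewrite mul1n; lia.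
    rewrite mul0n add0n ltn_neqAle mB // andbT; apply/eqP => eqQ'.
    by have := maxB _ sQ' (esym eqQ') _ Q'a2; rewrite h2.
  - by rewrite cN Qa2 andbF; lia.
  - by rewrite cN Qa2 andbF.
  exists D'; first by rewrite mem_cat D'in orbT.
  exists Q'; split=> //.
  - by move=> i Qi; apply: QQ'; rewrite /= Qi.
  - by move: cQ'; rewrite !cN Qa2 (QQ' _ Qa2) !andbF.
  move=> i /DQ'[|[b]]; first by left.
  rewrite mem_cat mem_nseq => /orP[/andP[_ /eqP->]|bA bl]; last by right; exists b.
  by rewrite /leaves /= (QQ' _ Qa2) !andbF.
have la : leaves Q a by rewrite /leaves Qa1.
have [||||D' D'in [Q' [sQ' QQ' cQ' DQ']]] :=
  IH R (set_bit D a.1) Q (cut M A).-1 sQ _ _ _ _.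
- by move=> Q' sQ' QQ'; have := minQ _ sQ' QQ'; rewrite !cA la; case: leaves; lia.
- by move=> Q' /mB; rewrite (cA Q'); case: leaves; lia.
- by move: le_f'; rewrite !(cA Q) la; lia.
- by move: lt_c; rewrite cA; lia.
(* If [Q'] did not leave [a], then [cut Q' A = cut Q' R <= cut Q R < cut Q A], against [minQ]. *)
have la' : leaves Q' a.
  apply: contraT => nl; have := minQ _ sQ' QQ'.
  by rewrite !cA la (negbTE nl); lia.
exists D'; first by rewrite mem_cat D'in.
exists Q'; split=> //.
- by move=> i Qi; apply: QQ'; rewrite /= Qi.
- by rewrite !cA la la' leq_add2l.
move=> i /DQ'[|[b bR bl]].
  rewrite has_set_bit => /predU1P[->|]; last by left.
  by right; exists a; rewrite ?eqxx ?(perm_mem h3) ?mem_head.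
by right; exists b => //; rewrite (perm_mem h3) inE bR orbT.
Qed.

(** [E] lists the arcs deleted on the branch that outputs [D'], and [Q] is the final cut there,
    which no remaining arc leaves. Hence [E] covers, with multiplicity, all original arcs leaving
    [Q], and an arc of multiplicity above [f] cannot leave it. *)
Lemma enum_cuts_sound f c A B0 s D D' : D' \in enum_cuts f c A B0 s D ->
  (forall i, has_bit D i -> has_bit D' i) /\
  exists Q (E : seq darc), [/\ separates s B0 Q, size E <= f,
    forall a, leaves Q a -> count_mem a A <= count_mem a E &
    forall a, a \in E -> has_bit D' a.1].
Proof.
elim: f A D => [|f IH] A D /=; case E: max_flow => [B|] //;
  have := find_arcP A B; case: (find_arc A B) => [[a R] [h1 h2 h3]|h] //.
- rewrite inE => /eqP ->; split=> //; exists (outside B), [::].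
  have [sB _ _] := max_flow_some E; split=> // a /andP[/= a1 /negbNE a2].
  by rewrite leqn0; apply: contraT; rewrite -lt0n -has_count has_pred1 => /h /(_ a2); rewrite (negbTE a1).
- rewrite mem_cat => /orP[] /IH [DD' [Q [L [sQ szL cL LD]]]].
    split=> [i Di|]; first by apply: DD'; rewrite has_set_bit Di orbT.
    exists Q, (a :: L); split=> //= b.
      by move=> /cL; rewrite (permP h3) /=; lia.
    by rewrite inE => /predU1P[->|/LD//]; apply: DD'; rewrite has_set_bit eqxx.
  split=> //; exists Q, L; split=> //; first exact: leqW.
  by move=> b /cL; rewrite count_cat; apply: leq_trans; exact: leq_addl.
rewrite inE => /eqP ->; split=> //; exists (outside B), [::].
have [sB _ _] := max_flow_some E; split=> // a /andP[/= a1 /negbNE a2].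
by rewrite leqn0; apply: contraT; rewrite -lt0n -has_count has_pred1 => /h /(_ a2); rewrite (negbTE a1).
Qed.

(** * The split network of a digraph *)

Fixpoint vertex_arcs (V : seq bool) (x u c : nat) : seq darc :=
  if V is b :: V' then
    let R := vertex_arcs V' x.+1 u.+1 c in
    if b then nseq c (x, u) ++ R else (x, u) :: R
  else [::].

Fixpoint row_arcs (r : seq bool) (u y c : nat) (A : seq darc) : seq darc :=
  if r is b :: r' then
    let R := row_arcs r' u y.+1 c A in if b then nseq c (u, y) ++ R else R
  else A.

Fixpoint edge_arcs (M : seq (seq bool)) (u c : nat) (A : seq darc) : seq darc :=
  if M is r :: M' then row_arcs r u 0 c (edge_arcs M' u.+1 c A) else A.

Lemma count_vertex_arcs P V x u c : count P (vertex_arcs V x u c) =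
  \sum_(i < size V) P (x + i, u + i) * (if has_bit V i then c else 1).
Proof.
elim: V x u => [|b V IH] x u /=; first by rewrite big_ord0.
rewrite big_ord_recl !addn0 /= /has_bit /=.
under eq_bigr => i _ do rewrite !addnS -!addSn.
by case: b; rewrite /= ?count_cat ?count_nseq IH ?muln1.
Qed.

Lemma count_row_arcs P r u y c A : count P (row_arcs r u y c A) =
  \sum_(i < size r) P (u, y + i) * (has_bit r i * c) + count P A.
Proof.
elim: r y => [|b r IH] y /=; first by rewrite big_ord0.
rewrite big_ord_recl !addn0 /= /has_bit /=.
under eq_bigr => i _ do rewrite !addnS -!addSn.
by case: b; rewrite /= ?count_cat ?count_nseq IH ?mul1n ?mul0n ?muln0 ?addnA.
Qed.

Lemma count_edge_arcs P M u c A : count P (edge_arcs M u c A) =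
  \sum_(j < size M) \sum_(i < size (nth [::] M j))
     P (u + j, nat_of_ord i) * (has_bit (nth [::] M j) i * c) + count P A.
Proof.
elim: M u => [|r M IH] u /=; first by rewrite big_ord0.
rewrite big_ord_recl /= count_row_arcs IH addnA addn0; congr (_ + _ + _).
by apply: eq_bigr => j _; rewrite /= addnS -addSn.
Qed.

Section Network.
Variable n : nat.
Implicit Types (e : rel 'I_n) (A T S : {set 'I_n}).

Definition bits A : seq bool := [seq i \in A | i <- enum 'I_n].
Definition rel_bits e : seq (seq bool) :=
  [seq [seq e i j | j <- enum 'I_n] | i <- enum 'I_n].

Lemma has_map_enum (p : pred 'I_n) (i : 'I_n) :
  has_bit [seq p j | j <- enum 'I_n] i = p i.
Proof. by rewrite /has_bit (nth_map i) ?size_enum_ord // nth_ord_enum. Qed.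

Lemma has_bits_lt A i : has_bit (bits A) i -> i < n.
Proof.
move=> h; rewrite ltnNge; apply/negP => le; move: h.
by rewrite /has_bit nth_default // size_map size_enum_ord.
Qed.

(* The entry copy of vertex [x] is node [x], its exit copy is node [n + x];
   the multiplicity [c] stands for an infinite capacity. *)
Definition network e (Vinf : {set 'I_n}) (c : nat) : seq darc :=
  edge_arcs (rel_bits e) n c (vertex_arcs (bits Vinf) 0 n c).

(** The predicate is arbitrary because the formula serves both for cut values and for the
    multiplicity of a single arc. *)
Lemma count_network P e Vinf c : count P (network e Vinf c) =
  \sum_(x < n) \sum_(y < n) P (n + x, nat_of_ord y) * (e x y * c)
  + \sum_(x < n) P (nat_of_ord x, n + x) * (if x \in Vinf then c else 1).
Proof.
rewrite count_edge_arcs count_vertex_arcs.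
have -> : size (rel_bits e) = n by rewrite size_map size_enum_ord.
have -> : size (bits Vinf) = n by rewrite size_map size_enum_ord.
congr (_ + _).
  apply: eq_bigr => x _; rewrite (nth_map x) ?size_enum_ord // nth_ord_enum.
  by rewrite size_map size_enum_ord; apply: eq_bigr => y _; rewrite has_map_enum.
by apply: eq_bigr => x _; rewrite add0n has_map_enum.
Qed.

Lemma mem_network e Vinf c a : a \in network e Vinf c ->
  (exists x y : 'I_n, e x y /\ a = (n + x, nat_of_ord y)) \/
  exists x : 'I_n, a = (nat_of_ord x, n + x).
Proof.
rewrite -has_pred1 has_count count_network addn_gt0 !lt0n.
rewrite !sum_nat_eq0 => /orP[]/forallPn[x]; rewrite implyTb.
  rewrite sum_nat_eq0 => /forallPn[y]; rewrite implyTb !muln_eq0 !negb_or !eqb0 !negbK.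
  by case/and3P=> /eqP <- exy _; left; exists x, y.
rewrite muln_eq0 negb_or eqb0 negbK => /andP[/eqP <- _].
by right; exists x.
Qed.

(** An arc of multiplicity [c] leaving [Q] would alone contribute [c] to the cut. *)
Lemma cut_network_edge e Vinf c Q (x y : 'I_n) : cut Q (network e Vinf c) < c ->
  e x y -> Q (n + x) -> Q y.
Proof.
move=> lt exy Qx; apply: contraT => Qy; move: lt; rewrite ltnNge /cut count_network.
by rewrite (bigD1 x) //= (bigD1 y) //= {1}/leaves /= Qx Qy exy !mul1n -!addnA leq_addr.
Qed.

Lemma cut_network_inf e Vinf c Q (x : 'I_n) : cut Q (network e Vinf c) < c ->
  x \in Vinf -> Q x -> Q (n + x).
Proof.
move=> lt xV Qx; apply: contraT => Qnx; move: lt; rewrite ltnNge /cut count_network.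
rewrite [X in _ + X](bigD1 x) //= {2}/leaves /= Qx Qnx xV mul1n addnCA.
by rewrite leq_addr.
Qed.

(** * Reachability and minimal separators *)

Lemma reach_notin e S A y : y \in reach e S A -> y \notin S.
Proof.
rewrite inE => /existsP[x /andP[]]; rewrite inE => /andP[xS _] /connectP[p].
elim: p x xS => [|z p IH] x xS /=; first by move=> _ ->.
by case/andP => /and3P[_ zS _] /(IH _ zS).
Qed.

Lemma reach_ind (P : pred 'I_n) e S A :
  (forall x, x \in A -> x \notin S -> P x) ->
  (forall x y, P x -> e x y -> y \notin S -> P y) ->
  forall y, y \in reach e S A -> P y.
Proof.
move=> P0 P1 y; rewrite inE => /existsP[x /andP[]].
rewrite inE => /andP[xS xA] /connectP[p]; have := P0 _ xA xS.
elim: p x {xS xA} => [|z p IH] x Px /=; first by move=> _ ->.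
by case/andP => /and3P[_ zS exz]; apply: IH; apply: P1 exz zS.
Qed.

Lemma reach0 e S A x : x \in A -> x \notin S -> x \in reach e S A.
Proof.
by move=> xA xS; rewrite inE; apply/existsP; exists x; rewrite in_setD xS xA connect0.
Qed.

Lemma reach_step e S A x y :
  x \in reach e S A -> e x y -> y \notin S -> y \in reach e S A.
Proof.
move=> xR exy yS; have xS := reach_notin xR.
move: xR; rewrite !inE => /existsP[z /andP[zA zx]]; apply/existsP; exists z.
by rewrite zA (connect_trans zx) // connect1 // /del_vertices /= xS yS exy.
Qed.

(** If no reached vertex had an arc to [x], restoring [x] would not enlarge the reach, and [S :\ x]
    would still separate. *)
Lemma minimal_separator_in e Vinf v T S x :
  minimal_separator e Vinf [set v] T S -> x \in S ->
  exists2 r, r \in reach e S [set v] & e r x.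
Proof.
case/minsetP => sepS minS xS.
have [[r rR erx]|no] : (exists2 r, r \in reach e S [set v] & e r x) \/
    forall r, r \in reach e S [set v] -> ~~ e r x.
  case: (boolP [exists r in reach e S [set v], e r x]) => [/exists_inP|/exists_inPn]; by [left|right].
  by exists r.
case/and5P: (sepS) => v0 T0 dvT subS dis.
have sub : reach e (S :\ x) [set v] \subset reach e S [set v].
  apply/subsetP; apply: reach_ind => [z|y z yR eyz].
    rewrite inE => /eqP -> vS; apply: reach0; first by rewrite inE.
    have : v \notin ~: ([set v] :|: T :|: Vinf) by rewrite !inE eqxx.
    by apply: contraNN; apply: subsetP.
  rewrite in_setD1 negb_and negbK => /predU1P[zx|zS]; last exact: reach_step eyz zS.
  by have := no _ yR; rewrite -zx eyz.
have : separator e Vinf [set v] T (S :\ x).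
  rewrite /separator v0 T0 dvT (subset_trans (subD1set _ _) subS) /=.
  exact: disjointWl sub dis.
move/minS/(_ (subD1set _ _)) => eqS; move: xS; rewrite -eqS.
by rewrite !inE eqxx.
Qed.

(** Only entry nodes are read off: the tail of a deleted vertex arc is the vertex that it stands
    for. *)
Definition bitset (D : seq bool) : {set 'I_n} := [set x | has_bit D (nat_of_ord x)].

Definition candidates e Vinf T (f : nat) (v : nat) : seq (seq bool) :=
  enum_cuts f (n + n).+1 (network e Vinf (n + n).+1) (bits T) (n + v) [::].

(** At most [f <= n + n] arcs were deleted, fewer than the multiplicity of an infinite arc. The
    final cut therefore leaves only vertex arcs, and these are recorded in [D]. Taking out [v] is
    harmless because the source is already the exit node of [v]. *)
Lemma candidates_sound e Vinf T f (v : 'I_n) D :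
  f <= n + n -> v \notin T -> T != set0 ->
  D \in candidates e Vinf T f v -> bitset D \subset ~: (T :|: Vinf) ->
  separator e Vinf [set v] T (bitset D :\ v).
Proof.
move=> lef vT T0 /enum_cuts_sound[_ [Q [E [[Qv QT] szE cE ED]]]] /subsetP subD.
have noninf a : (n + n).+1 <= count_mem a (network e Vinf (n + n).+1) ->
    Q a.1 -> Q a.2.
  move=> big Q1; apply: contraT => Q2.
  have := cE a; rewrite /leaves Q1 Q2 => /(_ isT) le1.
  by have := leq_trans (leq_trans big le1) (leq_trans (count_size _ _) (leq_trans szE lef)); rewrite ltnn.
have edge (x y : 'I_n) : e x y -> Q (n + x) -> Q y.
  move=> exy; apply: (noninf (n + x, nat_of_ord y)); rewrite count_network.
  by rewrite (bigD1 x) //= (bigD1 y) //= eqxx exy !mul1n -!addnA leq_addr.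
have vert (x : 'I_n) : x \notin bitset D :\ v -> Q x -> Q (n + x).
  rewrite !inE negb_and negbK => /predU1P[-> //|xD] Qx; apply: contraT => Qnx.
  have := cE (nat_of_ord x, n + x); rewrite /leaves /= Qx Qnx => /(_ isT).
  rewrite count_network [X in _ + X](bigD1 x) //= eqxx mul1n => le1.
  have /ED /= : (nat_of_ord x, n + x) \in E.
    by rewrite -has_pred1 has_count; apply: leq_trans le1; rewrite addnCA; case: ifP.
  by rewrite (negbTE xD).
apply/and5P; split=> //.
- by apply/set0Pn; exists v; rewrite inE.
- by rewrite disjoints1.
- apply/subsetP => x; rewrite !inE => /andP[xv xD]; rewrite (negbTE xv) /=.
  by have := subD x; rewrite !inE; apply.
rewrite disjoint_subset; apply/subsetP => x xR.
have Qx : Q (n + x) && ((nat_of_ord x == v) || Q x).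
  move: x xR; apply: reach_ind => [x|x y /andP[Qx _] exy yD].
    by rewrite inE => /eqP -> _; rewrite Qv eqxx.
  by have Qy := edge _ _ exy Qx; rewrite (vert _ yD Qy) Qy orbT.
rewrite inE; case/andP: Qx => _ /orP[/eqP/val_inj -> //|Qx].
apply/negP => xT; suff /QT : has_bit (bits T) x by rewrite Qx.
by rewrite has_map_enum.
Qed.

(** [S] is turned into the cut [Q] made of the exits of [R] and the entries of [R :|: S]. The
    enumeration returns some [D] with a cut [Q'] containing [Q] and of no larger value, and
    importance of [S] identifies the vertex arcs leaving [Q'] with [S]. So [bitset D] lies in [S];
    it separates by soundness, and minimality of [S] gives equality. *)
Lemma candidates_complete e Vinf T k (v : 'I_n) S : k <= n -> #|S| <= k ->
  important_separator e Vinf [set v] T S ->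
  exists2 D, D \in candidates e Vinf T (k + k) v & bitset D = S.
Proof.
move=> le_kn le_Sk /andP[minS]; rewrite negb_exists => /forallP impS.
have sepS := minsetp minS; case/and5P: (sepS) => v0 T0 dvT /subsetP subS disS.
set R := reach e S [set v] in disS.
have vT : v \notin T by rewrite -disjoints1.
have vS : v \notin S by apply/negP => /subS; rewrite !inE eqxx.
have vR : v \in R by apply: reach0; rewrite ?inE.
have ST x : x \in S -> x \notin T by move/subS; rewrite !inE !negb_or => /andP[/andP[]].
have SV x : x \in S -> x \notin Vinf by move/subS; rewrite !inE !negb_or => /andP[/andP[]].
set c := (n + n).+1.
have ltSc : #|S| < c.
  by rewrite ltnS (leq_trans le_Sk) // (leq_trans le_kn) // leq_addr.
set A := network e Vinf c.
pose Q : pred nat := fun i => [exists x : 'I_n,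
  ((i == x) && (x \in R :|: S)) || ((i == n + x) && (x \in R))].
have Qin (x : 'I_n) : Q x = (x \in R :|: S).
  apply/existsP/idP => [[y /orP[]/andP[/eqP E]]|xRS]; last by exists x; rewrite eqxx xRS.
    by rewrite (val_inj E).
  by have := ltn_ord x; rewrite E ltnNge leq_addr.
have Qout (x : 'I_n) : Q (n + x) = (x \in R).
  apply/existsP/idP => [[y /orP[]/andP[/eqP E]]|xRS]; last by exists x; rewrite eqxx xRS orbT.
    by have := ltn_ord y; rewrite -E ltnNge leq_addr.
  by rewrite (val_inj (addnI E)).
have sepQ : separates (n + v) (bits T) Q.
  split=> [|i hi]; first by rewrite Qout.
  have lti := has_bits_lt hi; move: hi; rewrite -[i]/(val (Ordinal lti)) has_map_enum Qin inE.
  move=> iT; apply/norP; split; last by apply: contraL iT => /ST.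
  by apply: contraL iT => /(disjointFr disS) ->.
have cutQ : cut Q A <= #|S|.
  rewrite /cut count_network big1 => [|x _]; last first.
    rewrite big1 // => y _; rewrite /leaves /= Qout Qin.
    case xR: (x \in R) => //=; case exy: (e x y); rewrite ?muln0 //=.
    have [yS|yS] := boolP (y \in S); first by rewrite inE yS orbT.
    by rewrite inE (reach_step xR exy yS).
  rewrite add0n -sum1_card [X in _ <= X]big_mkcond /=; apply: leq_sum => x _.
  rewrite /leaves /= Qin Qout inE; have [xR|xR] /= := boolP (x \in R); first by [].
  by have [xS|//] := boolP (x \in S); rewrite (negbTE (SV _ xS)).
(* The vertex arcs leaving [Q'] form a separator [S'] with at most [#|S|] elements and a reach
   containing [R], so importance makes the reaches equal. A vertex of [S] has an in-neighbour in
   [R]; outside [S'] it would be reached. Hence [S] is contained in [S'], and equal to it by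
   cardinality. *)
have key Q' : separates (n + v) (bits T) Q' -> subpred Q Q' -> cut Q' A <= #|S| ->
    [set x : 'I_n | Q' x && ~~ Q' (n + x)] = S /\ #|S| <= cut Q' A.
  move=> [Q'v Q'T] QQ' cut'; set S' := finset _.
  have ltc : cut Q' A < c := leq_ltn_trans cut' ltSc.
  have leS' : #|S'| <= cut Q' A.
    rewrite /cut count_network -sum1_card big_mkcond /=.
    apply: leq_trans (leq_addl _ _); apply: leq_sum => x _.
    by rewrite inE /leaves /=; case: andP => // _; rewrite mul1n; case: ifP.
  have QT' (x : 'I_n) : Q' x -> x \notin T.
    by apply: contraL => xT; apply: Q'T; rewrite has_map_enum.
  have vS' : v \notin S' by rewrite inE Q'v andbF.
  have RQ x : x \in reach e S' [set v] -> Q' (n + x) && ((x == v) || Q' x).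
    move: x; apply: reach_ind => [x|x y /andP[Qx _] exy].
      by rewrite inE => /eqP -> _; rewrite Q'v eqxx.
    have Qy := cut_network_edge ltc exy Qx.
    by rewrite inE Qy negbK orbT => ->.
  have sepS' : separator e Vinf [set v] T S'.
    rewrite /separator v0 T0 dvT /=; apply/andP; split.
      apply/subsetP => x; rewrite !inE => /andP[Qx Qnx].
      rewrite !negb_or (QT' _ Qx) andbT; apply/andP; split.
        by apply: contraNneq Qnx => ->.
      by apply: contraNN Qnx => xV; apply: cut_network_inf ltc xV Qx.
    rewrite disjoint_subset; apply/subsetP => x /RQ /andP[_]; rewrite inE.
    by case/orP => [/eqP -> //|/QT'].
  have RR : R \subset reach e S' [set v].
    apply/subsetP => x xR; suff : (x \in R) && (x \in reach e S' [set v]) by case/andP.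
    move: x xR; apply: reach_ind => [x|x y /andP[xR xR'] exy yS].
      by move=> /set1P -> _; rewrite vR reach0 ?set11.
    have yR := reach_step xR exy yS; rewrite yR /=; apply: reach_step xR' exy _.
    by rewrite inE negb_and negbK [Q' (n + y)]QQ' ?orbT // Qout.
  have := impS S'; rewrite sepS' (leq_trans leS' cut') /=.
  rewrite properEneq RR andbT negbK => /eqP eqR.
  have SS' : S \subset S'.
    apply/subsetP => x xS; have [r rR erx] := minimal_separator_in minS xS.
    apply: contraT => xS'; move: rR; rewrite eqR => rR.
    by have := reach_step rR erx xS'; rewrite -eqR => /reach_notin; rewrite xS.
  have eqS : S = S' by apply/eqP; rewrite eqEcard SS' (leq_trans leS' cut').
  by rewrite {2}eqS; split.
have minQ Q' : separates (n + v) (bits T) Q' -> subpred Q Q' -> cut Q A <= cut Q' A.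
  move=> sQ' QQ'; have [le|lt] := leqP (cut Q' A) #|S|.
    by apply: leq_trans cutQ (proj2 (key _ sQ' QQ' le)).
  by apply: leq_trans cutQ (ltnW lt).
have [|||D Din [Q' [sQ' QQ' cQ' DQ']]] :=
    @enum_cuts_complete (k + k) c A (bits T) (n + v) [::] Q 0 sepQ minQ.
- by [].
- by rewrite addn0 mul2n -addnn leq_add // (leq_trans cutQ).
- exact: leq_ltn_trans cutQ ltSc.
exists D => //.
have leQ' := leq_trans cQ' cutQ.
have ltc : cut Q' A < c := leq_ltn_trans leQ' ltSc.
have [eS _] := key _ sQ' QQ' leQ'.
(* Every bit of [D] is the tail of an arc leaving [Q']. Such an arc is no edge arc, since the cut is
   below [c], so it is the vertex arc of an element of [S]. *)
have DS : bitset D \subset S.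
  apply/subsetP => x; rewrite inE => /DQ'[|[a aA /andP[/eqP ax la]]].
    by rewrite /has_bit nth_nil.
  rewrite -eS inE; move: la (la); rewrite {1}/leaves ax => /andP[-> Qa2] la /=.
  apply: contraT => /negbNE Qnx.
  case: (mem_network aA) => [[y [z [eyz Ea]]]|[y Ea]]; move: la Qa2 ax.
    rewrite Ea /leaves /= => /andP[Qy _] Qz _.
    by rewrite (cut_network_edge ltc eyz Qy) in Qz.
  by rewrite Ea /= => _ Qy yx; rewrite -yx in Qnx; rewrite Qnx in Qy.
have sepD : separator e Vinf [set v] T (bitset D).
  have -> : bitset D = bitset D :\ v.
    apply/setP => x; rewrite in_setD1; case: eqP => // ->.
    by apply: contraNF vS; apply: subsetP.
  apply: candidates_sound Din _ => //; first exact: leq_add.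
  apply: subset_trans DS _; apply/subsetP => x xS; rewrite !inE.
  by rewrite (negbTE (ST _ xS)) (negbTE (SV _ xS)).
by case/minsetP: minS => _ /(_ _ sepD DS).
Qed.

End Network.

(** * Tries and shared coin flips *)

(** A set is a path of [c] bits, and its leaf lists the vertices having it as a candidate. Equal
    sets thus meet in one leaf, and share one coin, without any comparison of trees. *)
Fixpoint trie (c : nat) : Type :=
  if c is c'.+1 then option (trie c' * trie c')%type else seq nat.

Definition trie_nil (c : nat) : trie c :=
  if c is c'.+1 return trie c then None else [::].

Fixpoint insert (c : nat) : trie c -> seq bool -> nat -> trie c :=
  if c is c'.+1 return trie c -> seq bool -> nat -> trie c then fun t D v =>
    let l := if t is Some (l, _) then l else trie_nil c' in
    let r := if t is Some (_, r) then r else trie_nil c' in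
    if head false D then Some (l, insert r (behead D) v)
    else Some (insert l (behead D) v, r)
  else fun t _ v => v :: t.

Fixpoint lookup (c : nat) : trie c -> seq bool -> seq nat :=
  if c is c'.+1 return trie c -> seq bool -> seq nat then fun t K =>
    if t is Some (l, r) then
      if head false K then lookup r (behead K) else lookup l (behead K)
    else [::]
  else fun t _ => t.

Fixpoint keys (c : nat) : trie c -> seq (seq bool) :=
  if c is c'.+1 return trie c -> seq (seq bool) then fun t =>
    if t is Some (l, r) then
      [seq false :: K | K <- keys l] ++ [seq true :: K | K <- keys r]
    else [::]
  else fun t => if t is [::] then [::] else [:: [::]].

Fixpoint payloads (c : nat) : trie c -> seq (seq nat) :=
  if c is c'.+1 return trie c -> seq (seq nat) then fun t =>
    if t is Some (l, r) then payloads l ++ payloads r else [::]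
  else fun t => if t is [::] then [::] else [:: t].

(** The canonical form of a bit list as a trie path: missing bits are [false], and bits from [c] on,
    such as those of exit nodes, are dropped. *)
Definition prefix_bits (c : nat) (D : seq bool) : seq bool := mkseq (has_bit D) c.

Lemma prefix_bitsS c D :
  prefix_bits c.+1 D = head false D :: prefix_bits c (behead D).
Proof.
rewrite /prefix_bits /mkseq /= (iotaDl 1 0) -map_comp.
by case: D => [|b D]; congr (_ :: _); apply: eq_map => i; rewrite /= /has_bit ?nth_nil.
Qed.

Lemma lookup_nil c K : lookup (trie_nil c) K = [::].
Proof. by case: c. Qed.

Lemma lookup_insert c (t : trie c) D v K : lookup (insert t D v) K =
  if prefix_bits c D == prefix_bits c K then v :: lookup t K else lookup t K.
Proof.
elim: c t D K => [|c IH] t D K //=; rewrite !prefix_bitsS eqseq_cons.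
case: t => [[l r]|]; case: (head false D) => /=; case: (head false K) => //=;
  by rewrite ?IH ?lookup_nil.
Qed.

(** Both traversals visit the leaves in the same order, so the coin with index [j] belongs to the
    key with index [j]. *)
Lemma payloadsE c (t : trie c) : payloads t = [seq lookup t K | K <- keys t].
Proof.
elim: c t => [|c IH] /=; first by case.
case=> [[l r]|] //; rewrite map_cat -!map_comp !IH.
by congr (_ ++ _); apply: eq_map.
Qed.

Lemma keys_uniq c (t : trie c) : uniq (keys t).
Proof.
elim: c t => [|c IH] /=; first by case.
case=> [[l r]|] //; rewrite cat_uniq !map_inj_uniq ?IH //=; try by move=> ? ? [].
by rewrite andbT; apply/hasPn => _ /mapP[K _ ->]; apply/mapP => -[].
Qed.

Lemma mem_keys c (t : trie c) K :
  (K \in keys t) = (size K == c) && (lookup t K != [::]).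
Proof.
elim: c t K => [|c IH] /=; first by case=> [|v s] [|b K].
move=> t [|b K]; first by case: t => [[l r]|] //; rewrite mem_cat; apply/norP; split; apply/mapP => -[].
case: t => [[l r]|] /=; last by rewrite andbF.
have inj b0 : injective (cons b0 : seq bool -> seq bool) by move=> ? ? [].
rewrite mem_cat eqSS; case: b; rewrite /= (mem_map (inj _)) IH ?orbF //.
  by case: (boolP (_ \in [seq false :: _ | _ <- _])) => // /mapP[].
by case: (boolP (_ \in [seq true :: _ | _ <- _])) => [/mapP[]|] //; rewrite orbF.
Qed.

Lemma size_keys_insert c (t : trie c) D v :
  size (keys (insert t D v)) <= (size (keys t)).+1.
Proof.
have k0 c' : keys (trie_nil c') = [::] by case: c'.
elim: c t D => [|c IH] t D //=.
have := IH (trie_nil c) (behead D); rewrite k0 => IH0.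
case: t => [[l r]|]; case: (head false D) => /=; rewrite ?size_cat ?size_map ?k0 /= ?size_cat ?size_map ?k0.
- by rewrite -addnS leq_add2l; apply: IH.
- by rewrite -addSn leq_add2r; apply: IH.
- exact: IH0.
- by rewrite addn0.
Qed.

Fixpoint collect (c : nat) (G : nat -> seq (seq bool)) (Tb : seq bool) (v : nat)
    (t : trie c) : trie c :=
  if Tb is b :: Tb' then
    collect G Tb' v.+1
      (if b then t else foldl (fun t D => insert t D v) t (G v))
  else t.

Lemma mem_lookup_foldl c (t : trie c) v s K i :
  (i \in lookup (foldl (fun t D => insert t D v) t s) K) =
  (i \in lookup t K) || (i == v) && has (fun D => prefix_bits c D == prefix_bits c K) s.
Proof.
elim: s t => [|D s IH] t /=; first by rewrite andbF orbF.
rewrite IH lookup_insert; case: eqP => _ //=; rewrite inE.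
by case: (i == v); case: (i \in _).
Qed.

Lemma mem_lookup_collect c G Tb v (t : trie c) K i :
  (i \in lookup (collect G Tb v t) K) =
  (i \in lookup t K) ||
  [&& v <= i, i < v + size Tb, ~~ has_bit Tb (i - v) &
      has (fun D => prefix_bits c D == prefix_bits c K) (G i)].
Proof.
elim: Tb v t => [|b Tb IH] v t /=.
  by rewrite addn0; case: leqP; rewrite ?orbF //= andbF orbF.
rewrite IH addSnnS; case: (ltngtP v i) => [lt|lt|<-] /=.
- have -> : i - v = (i - v.+1).+1 by lia.
  rewrite /has_bit /=; case: b => //; rewrite mem_lookup_foldl.
  by rewrite gtn_eqF //= orbF.
- by case: b; rewrite ?orbF // mem_lookup_foldl ltn_eqF //= orbF.
rewrite subnn /has_bit /= orbF addnS ltnS leq_addr.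
by case: b; rewrite ?orbF // mem_lookup_foldl eqxx.
Qed.

Lemma size_keys_foldl c (t : trie c) v s :
  size (keys (foldl (fun t D => insert t D v) t s)) <= size (keys t) + size s.
Proof.
elim: s t => [|D s IH] t /=; first by rewrite addn0.
by apply: leq_trans (IH _) _; rewrite addnS -addSn leq_add2r size_keys_insert.
Qed.

Lemma size_keys_collect c G N Tb v (t : trie c) :
  (forall i, size (G i) <= N) ->
  size (keys (collect G Tb v t)) <= size (keys t) + size Tb * N.
Proof.
move=> leN; elim: Tb v t => [|b Tb IH] v t /=; first by rewrite addn0.
apply: leq_trans (IH _ _) _; rewrite mulSn addnA leq_add2r; case: b; first exact: leq_addr.
by apply: leq_trans (size_keys_foldl _ _ _) _; rewrite leq_add2l.
Qed.

(** * Sampling and forced coins *)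

Definition add_all (s : seq nat) (Z : seq bool) : seq bool := foldl set_bit Z s.

Fixpoint sample (L : seq (seq nat)) (w : seq bool) (Z : seq bool) : seq bool :=
  match L, w with
  | s :: L', b :: w' => sample L' w' (if b then add_all s Z else Z)
  | _, _ => Z
  end.

Lemma sample_cat L L' w Z :
  sample (L ++ L') w Z = sample L' (drop (size L) w) (sample L w Z).
Proof.
elim: L w Z => [|s L IH] w Z /=; first by rewrite drop0.
by case: w => [|b w]; [case: (L') | apply: IH].
Qed.

Lemma has_add_all s Z i : has_bit (add_all s Z) i = has_bit Z i || (i \in s).
Proof.
elim: s Z => [|v s IH] Z /=; first by rewrite orbF.
by rewrite [LHS]IH has_set_bit inE orbA [_ || (i == v)]orbC.
Qed.

Lemma sampleP L w Z i : size L <= size w ->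
  reflect (has_bit Z i \/ exists2 j, j < size L & nth false w j && (i \in nth [::] L j))
    (has_bit (sample L w Z) i).
Proof.
elim: L w Z => [|s L IH] w Z /=.
  by move=> _; apply: (iffP idP) => [|[//|[]//]]; left.
case: w => // b w /(IH w (if b then add_all s Z else Z)) {}IH.
apply: (iffP IH) => [[h|[j jL h]]|[h|[[|j] jL h]]].
- move: h; case: b {IH} => [|h]; last by left.
  by rewrite has_add_all => /orP[h|h]; [left|right; exists 0].
- by right; exists j.+1.
- by left; case: b {IH} => //; rewrite has_add_all h.
- by left; case: b {IH} h => //= h; rewrite has_add_all h orbT.
- by right; exists j.
Qed.

Lemma size_sample L w Z :
  (forall s, s \in L -> all (fun i => i < size Z) s) ->
  size (sample L w Z) = size Z.
Proof.
have szA s Z' : all (fun i => i < size Z') s -> size (add_all s Z') = size Z'.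
  elim: s Z' => //= v s IH Z' /andP[vZ sZ].
  have e : size (set_bit Z' v) = size Z' by rewrite size_set_nth; apply/maxn_idPr.
  by rewrite [LHS]IH e.
elim: L w Z => //= s L IH [|b w] Z h //=.
have e : size (if b then add_all s Z else Z) = size Z.
  by case: b; rewrite ?szA // h ?mem_head.
by rewrite IH e // => s' s'L; apply: h; rewrite inE s'L orbT.
Qed.

(** Overwriting the bits in [J] by [g] sends every tape into [E]. The overwritten bits, kept as a
    subset of [J], make this map injective. *)
Lemma card_forced_tapes m (J : {set 'I_m}) (g : 'I_m -> bool)
    (E : {set m.-tuple bool}) :
  (forall w : m.-tuple bool, (forall j, j \in J -> tnth w j = g j) -> w \in E) ->
  2 ^ m <= #|E| * 2 ^ #|J|.
Proof.
move=> hE.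
pose force (w : m.-tuple bool) := [tuple if j \in J then g j else tnth w j | j < m].
pose h (w : m.-tuple bool) := (force w, [set j in J | tnth w j]).
have injh : injective h.
  move=> w w' eh; apply: eq_from_tnth => j.
  have [jJ|jJ] := boolP (j \in J).
    by have /setP/(_ j) := congr1 snd eh; rewrite !inE jJ.
  have := congr1 (fun p => tnth p.1 j) eh.
  by rewrite !tnth_mktuple (negbTE jJ).
have -> : 2 ^ m = #|[set h w | w : m.-tuple bool]|.
  by rewrite card_imset // card_tuple card_bool.
rewrite -card_powerset -cardsX; apply: subset_leq_card.
apply/subsetP => _ /imsetP[w _ ->]; rewrite !inE /=; apply/andP; split.
  by apply: hE => j jJ; rewrite tnth_mktuple jJ.
by apply/subsetP => j; rewrite inE => /andP[].
Qed.

Lemma tape_prob_forced m (J : {set 'I_m}) (g : 'I_m -> bool)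
    (E : {set m.-tuple bool}) N :
  (forall w : m.-tuple bool, (forall j, j \in J -> tnth w j = g j) -> w \in E) ->
  #|J| <= N -> (2^-1 ^+ N <= tape_prob E)%R.
Proof.
move=> hE leN; have := card_forced_tapes hE => le1.
have le2 : 2 ^ m <= #|E| * 2 ^ N by apply: leq_trans le1 _; rewrite leq_mul2l leq_exp2l // leN orbT.
have p2 i : (0 < 2 ^+ i :> rat)%R by rewrite Num.Theory.exprn_gt0.
rewrite /tape_prob GRing.exprVn Num.Theory.ler_pdivlMr // GRing.mulrC.
rewrite Num.Theory.ler_pdivrMr // -!GRing.natrX -GRing.natrM.
by rewrite Num.Theory.ler_nat.
Qed.

(** * The random set *)

Section RandomSet.
Variables (n : nat) (e : rel 'I_n) (Vinf T : {set 'I_n}) (k : nat).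
(** A separator has at most [n] elements, so capping [k] at [n] loses none. It keeps the depth
    polynomial although [k] is given in binary. *)
Let f := minn k n + minn k n.
Let G := candidates e Vinf T f.

Definition candidate_trie : trie n := collect G (bits T) 0 (trie_nil n).

Definition random_bits (w : seq bool) : seq bool :=
  sample (payloads candidate_trie) w (nseq n false).

Definition random_set (w : seq bool) : {set 'I_n} := bitset n (random_bits w).

Lemma size_bits (A : {set 'I_n}) : size (bits A) = n.
Proof. by rewrite size_map size_enum_ord. Qed.

Lemma mem_candidate_trie K i : (i \in lookup candidate_trie K) =
  [&& i < n, ~~ has_bit (bits T) i &
      has (fun D => prefix_bits n D == prefix_bits n K) (G i)].
Proof. by rewrite mem_lookup_collect lookup_nil size_bits subn0. Qed.

Lemma payloads_lt s : s \in payloads candidate_trie -> all (fun i => i < n) s.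
Proof.
rewrite payloadsE => /mapP[K _ ->]; apply/allP => i.
by rewrite mem_candidate_trie => /andP[].
Qed.

Lemma size_random_bits w : size (random_bits w) = n.
Proof.
rewrite size_sample ?size_nseq // => s /payloads_lt; exact.
Qed.

Lemma bits_random_set w : bits (random_set w) = random_bits w.
Proof.
apply: (@eq_from_nth _ false); first by rewrite size_bits size_random_bits.
rewrite size_bits => i lti; rewrite -[i]/(val (Ordinal lti)).
by rewrite -[LHS]/(has_bit _ _) has_map_enum inE.
Qed.

Lemma size_payloads_candidate_trie :
  size (payloads candidate_trie) <= n * 4 ^ k.
Proof.
rewrite payloadsE size_map.
have := @size_keys_collect n G (2 ^ f) (bits T) 0 (trie_nil n) (fun i => size_enum_cuts _ _ _ _ _ _).
have -> : keys (trie_nil n) = [::] by case: (n).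
rewrite size_bits => le1; apply: leq_trans le1 _; rewrite add0n leq_mul2l.
rewrite -[4]/(2 ^ 2) -expnM leq_exp2l // /f; apply/orP; right; lia.
Qed.

Lemma mem_random_set w (v : 'I_n) : size (payloads candidate_trie) <= size w ->
  reflect (exists2 K, K \in keys candidate_trie &
             nth false w (index K (keys candidate_trie)) &&
             (nat_of_ord v \in lookup candidate_trie K))
          (v \in random_set w).
Proof.
set t := candidate_trie; move=> le; rewrite inE.
apply: (iffP (sampleP _ _ le)) => [[|[j]]|[K Kt /andP[wK vK]]].
- by rewrite /has_bit nth_nseq if_same.
- rewrite payloadsE size_map => jt /andP[wj]; rewrite (nth_map [::]) // => vj.
  by exists (nth [::] (keys t) j); rewrite ?mem_nth // index_uniq ?keys_uniq // wj.
right; exists (index K (keys t)); rewrite payloadsE ?size_map ?index_mem //.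
by rewrite wK (nth_map [::]) ?index_mem // nth_index.
Qed.

Lemma random_set_sub w : size (payloads candidate_trie) <= size w ->
  random_set w \subset ~: T.
Proof.
move=> le; apply/subsetP => v /(mem_random_set _ le)[K _ /andP[_]].
by rewrite mem_candidate_trie inE has_map_enum => /and3P[].
Qed.

Lemma bitset_prefix D : bitset n (prefix_bits n D) = bitset n D.
Proof. by apply/setP => x; rewrite !inE /has_bit nth_mkseq. Qed.

Lemma bitset_inj : {in [pred K | size K == n] &, injective (bitset n)}.
Proof.
move=> K K' /eqP sK /eqP sK' /setP eK; apply: (@eq_from_nth _ false); rewrite sK //.
by move=> i lti; have := eK (Ordinal lti); rewrite !inE.
Qed.

Lemma random_set_prob m (W Y : {set 'I_n}) :
  size (payloads candidate_trie) <= m ->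
  W \subset ~: (T :|: Vinf) -> thin e Vinf T W -> #|W| <= k ->
  (forall v, v \in Y -> exists2 W' : {set 'I_n},
     W' \subset W & important_separator e Vinf [set v] T W') ->
  (2^-1 ^+ (2 ^ (3 * k).+1) <= tape_prob
     [set w : m.-tuple bool | (W :&: random_set w == set0) && (Y \subset random_set w)])%R.
Proof.
set t := candidate_trie => le_m WTV thinW leWk impY.
pose key (j : nat) := nth [::] (keys t) j.
pose J := [set j : 'I_m | (j < size (keys t)) &&
  ((bitset n (key j) \subset W) || [exists x in W, nat_of_ord x \in lookup t (key j)])].
(* When [T] is empty there are no separators at all; then [Y] is empty and all demanded coins may be
   [false]. *)
pose g (j : 'I_m) := (T != set0) && (bitset n (key j) \subset W).
have szK K : K \in keys t -> size K == n by rewrite mem_keys => /andP[].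
have lef : f <= n + n by rewrite /f; lia.
have idx K : K \in keys t -> exists2 j : 'I_m, nat_of_ord j = index K (keys t) &
    (j < size (keys t)) && (key j == K).
  move=> Kt; have lt : index K (keys t) < m.
    by apply: leq_trans le_m; rewrite payloadsE size_map index_mem.
  by exists (Ordinal lt) => //; rewrite /key /= index_mem Kt nth_index /=.
apply: (@tape_prob_forced m J g).
  move=> w hw.
  have le_w : size (payloads candidate_trie) <= size w by rewrite size_tuple.
  rewrite inE; apply/andP; split.
    rewrite -subset0; apply/subsetP => x; rewrite in_setI => /andP[xW].
    case/(mem_random_set _ le_w) => K Kt /andP[wK xK].
    have [j jE /andP[jlt /eqP jK]] := idx _ Kt.
    have jJ : j \in J.
      by rewrite inE jlt jK; apply/orP; right; apply/existsP; exists x; rewrite xW.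
    have := hw _ jJ; rewrite (tnth_nth false) jE wK /g jK => /esym/andP[T0 KW].
    move: xK; rewrite mem_candidate_trie => /and3P[_ ]; rewrite has_map_enum => xT.
    case/hasP => D DG /eqP eDK.
    have bD : bitset n D = bitset n K by rewrite -bitset_prefix eDK bitset_prefix.
    (* The set [K] behind a coin that put [x] into the random set is contained in [W]. Since [K]
       without [x] separates [x] from [T], so does [W :\ x], against thinness. *)
    have := candidates_sound lef xT T0 DG; rewrite bD => /(_ (subset_trans KW WTV)).
    case/and5P => x0 _ dxT _ dis; have := thinW _ xW.
    rewrite inE => /negP[]; apply/and5P; split=> //.
      apply/subsetP => y; rewrite !inE => /andP[yx /(subsetP WTV)].
      by rewrite !inE (negbTE yx).
    apply: disjointWl dis; apply/subsetP => y; apply: reach_ind => [z|y' z y'R ey zW].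
      by move=> zx _; apply: reach0 => //; rewrite (set1P zx) in_setD1 eqxx.
    by apply: reach_step y'R ey _; apply: contraNN zW; apply/subsetP/setSD.
  apply/subsetP => v /impY[S SW impS].
  have leSk : #|S| <= minn k n.
    rewrite leq_min (leq_trans (subset_leq_card SW) leWk) /=.
    by rewrite -[X in _ <= X]card_ord max_card.
  have [D DG DS] := candidates_complete (geq_minr k n) leSk impS.
  case/andP: (impS) => /minsetp /and5P[_ T0]; rewrite disjoints1 => vT _ _ _.
  pose K := prefix_bits n D.
  have KP : prefix_bits n K = K.
    by apply: (@eq_from_nth _ false); rewrite !size_mkseq // => i lti; rewrite !nth_mkseq // /has_bit nth_mkseq.
  have vK : nat_of_ord v \in lookup t K.
    rewrite mem_candidate_trie ltn_ord has_map_enum vT; apply/hasP; exists D => //.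
    by rewrite KP.
  have Kt : K \in keys t.
    by rewrite mem_keys size_mkseq eqxx; case: (lookup t K) vK.
  have [j jE /andP[jlt /eqP jK]] := idx _ Kt.
  have KW : bitset n K \subset W by rewrite bitset_prefix DS.
  apply/(mem_random_set _ le_w); exists K => //; rewrite vK andbT -jE -tnth_nth hw.
    by rewrite /g T0 jK.
  by rewrite inE jlt jK KW.
(* Distinct coins carry distinct sets, so the demanded coins are counted by their sets: subsets of
   [W], or members of the families of vertices of [W]. *)
pose h (j : 'I_m) := bitset n (key j).
have injh : {in J &, injective h}.
  move=> i j; rewrite !inE => /andP[li _] /andP[lj _] /bitset_inj.
  rewrite !inE !szK ?mem_nth // => /(_ isT isT) /eqP.
  by rewrite nth_uniq ?keys_uniq // => /eqP/val_inj.
rewrite -(card_in_imset injh).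
have sub : h @: J \subset powerset W :|: \bigcup_(x in W) [set B in map (bitset n) (G x)].
  apply/subsetP => _ /imsetP[j jJ ->]; rewrite /h.
  move: jJ; rewrite 2!inE => /andP[lj /orP[sW|/existsP[x /andP[xW]]]].
    by rewrite inE sW.
  rewrite mem_candidate_trie => /and3P[_ _ /hasP[D DG /eqP eD]].
  apply/orP; right; apply/bigcupP; exists x => //; rewrite inE; apply/mapP; exists D => //.
  by rewrite -bitset_prefix -eD bitset_prefix.
apply: leq_trans (subset_leq_card sub) _.
apply: leq_trans (leq_card_setU _ _) _.
have le1 : #|powerset W| <= 2 ^ k by rewrite card_powerset leq_exp2l.
have le2 : #|\bigcup_(x in W) [set B in map (bitset n) (G x)]| <= k * 2 ^ (2 * k).
  apply: leq_trans (_ : \sum_(x in W) #|[set B in map (bitset n) (G x)]| <= _).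
    elim/big_rec2: _ => [|x a S _ IH]; first by rewrite cards0.
    by apply: leq_trans (leq_card_setU _ _) _; rewrite leq_add2l.
  apply: leq_trans (_ : \sum_(x in W) 2 ^ (2 * k) <= _); last first.
    by rewrite sum_nat_const leq_mul2r leWk orbT.
  apply: leq_sum => x _; rewrite cardsE.
  apply: leq_trans (card_size _) _; rewrite size_map; apply: leq_trans (size_enum_cuts _ _ _ _ _ _) _.
  by rewrite leq_exp2l // /f; lia.
apply: leq_trans (leq_add le1 le2) _.
have le3 : k <= 2 ^ k by apply: ltnW; apply: ltn_expl.
(* Both [2 ^ k] and [k * 4 ^ k] are at most [2 ^ (3 * k)], the latter by [k <= 2 ^ k]; their sum
   accounts for the successor in the exponent. *)
have -> : 2 ^ (3 * k).+1 = 2 ^ k * 2 ^ (2 * k) + 2 ^ k * 2 ^ (2 * k).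
  by rewrite addnn -muln2 -expnD expnSr; congr (2 ^ _ * 2); lia.
apply: leq_add; last by rewrite leq_mul2r le3 orbT.
by rewrite leq_pmulr // expn_gt0.
Qed.

End RandomSet.

(** * The program *)

(* Expressions indexed by the length of the environment, so that binders can be
   written as functions and variables need no explicit lifting. *)
Definition code := nat -> expr.

(** [j] is a de Bruijn level, which keeps its meaning when more binders are entered. *)
Definition var (j : nat) : code := fun d => Var (d - j.+1).
Definition leaf : code := fun _ => Defs.Nil.
Definition mkpair (a b : code) : code := fun d => Defs.Cons (a d) (b d).
Definition lproj (a : code) : code := fun d => Case (a d) Defs.Nil (Var 0).
Definition rproj (a : code) : code := fun d => Case (a d) Defs.Nil (Var 1).
Definition ifnode (a b c : code) : code := fun d => Case (a d) (c d) (b d.+2).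
Definition letin (a : code) (b : code -> code) : code :=
  fun d => Let (a d) (b (var d) d.+1).
Definition call (f : nat) (a : code) : code := fun d => Call f (a d).
Definition flip : code := fun _ => Flip.
Definition csucc (a : code) : code := mkpair leaf a.
Definition yes : code := csucc leaf.
Definition fundef (b : code -> code) : expr := b (var 0) 1.

Declare Scope code_scope.
Delimit Scope code_scope with code.
Bind Scope code_scope with code.
Notation "a ,, b" := (mkpair a b) (at level 60, right associativity) : code_scope.

Notation MAIN := 0.
Notation GET := 1.
Notation SET := 2.
Notation EQ := 3.
Notation FIND := 4.
Notation AUG := 5.
Notation FLOW := 6.
Notation REP := 7.
Notation ENUM := 8.
Notation INS := 9.
Notation ADDALL := 10.
Notation SAMPLE := 11.
Notation ADD := 12.
Notation MIN := 13.
Notation CAP := 14.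
Notation ROW := 15.
Notation ROWS := 16.
Notation VERT := 17.
Notation LOOP := 18.
Notation ZEROS := 19.

Section Program.
Local Open Scope code_scope.

(** [z] serves both as [n] in unary and as the bit list of the empty set, because [Leaf] encodes
    both zero and [false]. *)
Definition main_code := fundef (fun x =>
  letin (call ZEROS (lproj (rproj (rproj x)))) (fun z =>
  letin (csucc (call ADD (z ,, z))) (fun c =>
  letin (call CAP (lproj (rproj (rproj (rproj x))) ,, z)) (fun k =>
  letin (call ADD (k ,, k)) (fun f =>
  letin (call VERT (lproj (rproj x) ,, leaf ,, z ,, c)) (fun V =>
  letin (call ROWS (lproj x ,, z ,, c ,, V)) (fun A =>
  letin (call LOOP (lproj (rproj (rproj x)) ,, leaf ,, z ,, leaf ,, f ,, A ,, c ,,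
                    lproj (rproj (rproj x)) ,, z)) (fun t =>
  call SAMPLE (z ,, t ,, z))))))))).

Definition get_code := fundef (fun x =>
  let B := lproj x in let u := rproj x in
  ifnode u (call GET (rproj B ,, rproj u)) (lproj B)).

Definition set_code := fundef (fun x =>
  let B := lproj x in let u := rproj x in
  ifnode u (lproj B ,, call SET (rproj B ,, rproj u)) (yes ,, rproj B)).

Definition eq_code := fundef (fun x =>
  let u := lproj x in let v := rproj x in
  ifnode u (ifnode v (call EQ (rproj u ,, rproj v)) leaf) (ifnode v leaf yes)).

Definition find_code := fundef (fun x =>
  let A := lproj x in let B := rproj x in
  let skip := letin (call FIND (rproj A ,, B)) (fun r =>
    ifnode r (lproj r ,, lproj A ,, rproj r) leaf) in
  ifnode A
    (ifnode (call GET (B ,, lproj (lproj A))) skip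
      (ifnode (call GET (B ,, rproj (lproj A))) A skip))
    leaf).

Definition aug_code := fundef (fun x =>
  let A := lproj x in let B := lproj (rproj x) in let s := rproj (rproj x) in
  ifnode (call GET (B ,, s)) (yes ,, s ,, A)
    (letin (call FIND (A ,, B)) (fun r =>
      ifnode r
        (letin (call SET (B ,, lproj (lproj r))) (fun B' =>
         letin (call AUG (rproj r ,, B' ,, s)) (fun q =>
         ifnode (lproj q)
           (ifnode (call EQ (lproj (rproj q) ,, lproj (lproj r)))
             (yes ,, rproj (lproj r) ,,
                (rproj (lproj r) ,, lproj (lproj r)) ,, rproj (rproj q))
             (yes ,, lproj (rproj q) ,, lproj r ,, rproj (rproj q)))
           q)))
        (leaf ,, B)))).

Definition flow_code := fundef (fun x =>
  let c := lproj x in let A := lproj (rproj x) in let B := rproj (rproj x) in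
  ifnode c
    (letin (call AUG (A ,, B)) (fun q =>
       ifnode (lproj q) (call FLOW (rproj c ,, rproj (rproj q) ,, B)) q))
    leaf).

Definition rep_code := fundef (fun x =>
  let c := lproj x in let a := lproj (rproj x) in let A := rproj (rproj x) in
  ifnode c (a ,, call REP (rproj c ,, a ,, A)) A).

(** The trie is threaded through the recursion and each output is inserted at once, so no list of
    candidates is built. [ctx] packs the parameters that stay fixed. *)
Definition enum_code := fundef (fun x =>
  let f := lproj x in let A := lproj (rproj x) in let D := lproj (rproj (rproj x)) in
  let t := lproj (rproj (rproj (rproj x))) in
  let ctx := rproj (rproj (rproj (rproj x))) in
  let c := lproj ctx in let B := lproj (rproj ctx) in
  let s := lproj (rproj (rproj ctx)) in
  let z := lproj (rproj (rproj (rproj ctx))) in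
  let v := rproj (rproj (rproj (rproj ctx))) in
  letin (call FLOW (c ,, A ,, B ,, s)) (fun r =>
  ifnode r
    (letin (call FIND (A ,, rproj r)) (fun q =>
     ifnode q
       (ifnode f
          (letin (call SET (D ,, lproj (lproj q))) (fun D' =>
           letin (call ENUM (rproj f ,, rproj q ,, D' ,, t ,, ctx)) (fun t' =>
           letin (call REP (c ,, (s ,, rproj (lproj q)) ,, A)) (fun A' =>
           call ENUM (rproj f ,, A' ,, D ,, t' ,, ctx)))))
          t)
       (call INS (z ,, t ,, D ,, v))))
    t)).

Definition ins_code := fundef (fun x =>
  let c := lproj x in let t := lproj (rproj x) in
  let D := lproj (rproj (rproj x)) in let v := rproj (rproj (rproj x)) in
  ifnode c
    (ifnode (lproj D)
       (lproj t ,, call INS (rproj c ,, rproj t ,, rproj D ,, v))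
       (call INS (rproj c ,, lproj t ,, rproj D ,, v) ,, rproj t))
    (v ,, t)).

Definition addall_code := fundef (fun x =>
  let s := lproj x in let Z := rproj x in
  ifnode s (call ADDALL (rproj s ,, call SET (Z ,, lproj s))) Z).

(** A coin is flipped only at a nonempty leaf list, which matches the entries of [payloads]. *)
Definition sample_code := fundef (fun x =>
  let c := lproj x in let t := lproj (rproj x) in let Z := rproj (rproj x) in
  ifnode t
    (ifnode c
       (letin (call SAMPLE (rproj c ,, lproj t ,, Z)) (fun Z' =>
        call SAMPLE (rproj c ,, rproj t ,, Z')))
       (ifnode flip (call ADDALL (t ,, Z)) Z))
    Z).

Definition add_code := fundef (fun x =>
  ifnode (lproj x) (csucc (call ADD (rproj (lproj x) ,, rproj x))) (rproj x)).

Definition min_code := fundef (fun x =>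
  ifnode (lproj x)
    (ifnode (rproj x) (csucc (call MIN (rproj (lproj x) ,, rproj (rproj x)))) leaf)
    leaf).

Definition cap_code := fundef (fun x =>
  let k := lproj x in let z := rproj x in
  ifnode k
    (letin (call CAP (rproj k ,, z)) (fun u =>
     letin (call ADD (u ,, u)) (fun d =>
     call MIN (z ,, ifnode (lproj k) (csucc d) d))))
    leaf).

Definition row_code := fundef (fun x =>
  let r := lproj x in let u := lproj (rproj x) in
  let y := lproj (rproj (rproj x)) in let c := lproj (rproj (rproj (rproj x))) in
  let A := rproj (rproj (rproj (rproj x))) in
  ifnode r
    (letin (call ROW (rproj r ,, u ,, csucc y ,, c ,, A)) (fun R =>
     ifnode (lproj r) (call REP (c ,, (u ,, y) ,, R)) R))
    A).

Definition rows_code := fundef (fun x =>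
  let M := lproj x in let u := lproj (rproj x) in
  let c := lproj (rproj (rproj x)) in let A := rproj (rproj (rproj x)) in
  ifnode M
    (letin (call ROWS (rproj M ,, csucc u ,, c ,, A)) (fun R =>
     call ROW (lproj M ,, u ,, leaf ,, c ,, R)))
    A).

Definition vert_code := fundef (fun x =>
  let V := lproj x in let y := lproj (rproj x) in
  let u := lproj (rproj (rproj x)) in let c := rproj (rproj (rproj x)) in
  ifnode V
    (letin (call VERT (rproj V ,, csucc y ,, csucc u ,, c)) (fun R =>
     ifnode (lproj V) (call REP (c ,, (y ,, u) ,, R)) ((y ,, u) ,, R)))
    leaf).

Definition loop_code := fundef (fun x =>
  let T := lproj x in let v := lproj (rproj x) in
  let s := lproj (rproj (rproj x)) in let t := lproj (rproj (rproj (rproj x))) in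
  let ctx := rproj (rproj (rproj (rproj x))) in
  let f := lproj ctx in let A := lproj (rproj ctx) in
  let c := lproj (rproj (rproj ctx)) in
  let B := lproj (rproj (rproj (rproj ctx))) in
  let z := rproj (rproj (rproj (rproj ctx))) in
  ifnode T
    (letin (ifnode (lproj T) t
              (call ENUM (f ,, A ,, leaf ,, t ,, c ,, B ,, s ,, z ,, v))) (fun t' =>
     call LOOP (rproj T ,, csucc v ,, csucc s ,, t' ,, ctx)))
    t).

Definition zeros_code := fundef (fun x =>
  ifnode x (csucc (call ZEROS (rproj x))) leaf).

End Program.

Definition prog : program :=
  [:: main_code; get_code; set_code; eq_code; find_code; aug_code; flow_code;
      rep_code; enum_code; ins_code; addall_code; sample_code; add_code;
      min_code; cap_code; row_code; rows_code; vert_code; loop_code; zeros_code].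

(** * Execution of the program with time bounds *)

Definition lsub (x : tree) : tree := if x is Node l _ then l else Leaf.
Definition rsub (x : tree) : tree := if x is Node _ r then r else Leaf.

(** Exact times are relaxed to upper bounds, so that costs compose by arithmetic alone. [runf] below
    is for functions that leave the random bits untouched. *)
Definition run env a w x w' t :=
  exists2 s, s <= t & eval prog env a w s x w'.

Definition runf f x y t := forall w, run [:: x] (body prog f) w y w t.

Lemma run_le env a w x w' t t' : run env a w x w' t -> t <= t' -> run env a w x w' t'.
Proof. by case=> s le ev le'; exists s => //; apply: leq_trans le'. Qed.

Lemma run_conv env a w x x' w' t t' :
  run env a w x w' t -> x = x' -> t <= t' -> run env a w x' w' t'.
Proof. by move=> r <-; apply: run_le r. Qed.

Lemma run_var env i w x : nth Leaf env i = x -> run env (Var i) w x w 1.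
Proof. by move=> <-; exists 1 => //; constructor. Qed.

Lemma run_nil env w : run env Defs.Nil w Leaf w 1.
Proof. by exists 1 => //; constructor. Qed.

Lemma run_cons env a b w1 w2 w3 s t x y :
  run env a w1 x w2 s -> run env b w2 y w3 t ->
  run env (Defs.Cons a b) w1 (Node x y) w3 (s + t).+1.
Proof.
move=> [s' ls es] [t' lt et]; exists (s' + t').+1; first by rewrite ltnS leq_add.
by econstructor; eauto.
Qed.

Lemma run_case env a b c w1 w2 w3 s t x y : run env a w1 x w2 s ->
  match x with
  | Leaf => run env b w2 y w3 t
  | Node l r => run [:: l, r & env] c w2 y w3 t
  end -> run env (Case a b c) w1 y w3 (s + t).+1.
Proof.
move=> [s' ls es]; case: x es => [|l r] es [t' lt et];
  (exists (s' + t').+1; first by rewrite ltnS leq_add).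
  exact: EvCaseLeaf es et.
exact: EvCaseNode es et.
Qed.

Lemma run_flip env b w : run env Flip (b :: w) (enc_bool b) w 1.
Proof. by exists 1 => //; constructor. Qed.

Lemma run_left env a w1 w2 s x y : run env a w1 x w2 s -> lsub x = y ->
  run env (Case a Defs.Nil (Var 0)) w1 y w2 s.+2.
Proof.
move=> ra <-; apply: (@run_le _ _ _ _ _ (s + 1).+1); last by rewrite addn1.
apply: (run_case ra).
by case: x {ra} => [|l r]; [apply: run_nil | apply: run_var].
Qed.

Lemma run_right env a w1 w2 s x y : run env a w1 x w2 s -> rsub x = y ->
  run env (Case a Defs.Nil (Var 1)) w1 y w2 s.+2.
Proof.
move=> ra <-; apply: (@run_le _ _ _ _ _ (s + 1).+1); last by rewrite addn1.
apply: (run_case ra).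
by case: x {ra} => [|l r]; [apply: run_nil | apply: run_var].
Qed.

Lemma run_let env a b w1 w2 w3 s t x y :
  run env a w1 x w2 s -> run (x :: env) b w2 y w3 t ->
  run env (Let a b) w1 y w3 (s + t).+1.
Proof.
move=> [s' ls es] [t' lt et]; exists (s' + t').+1; first by rewrite ltnS leq_add.
by econstructor; eauto.
Qed.

Lemma run_callw env f a w1 w2 w3 s t x y :
  run env a w1 x w2 s -> run [:: x] (body prog f) w2 y w3 t ->
  run env (Call f a) w1 y w3 (s + t).+1.
Proof.
move=> [s' ls es] [t' lt et]; exists (s' + t').+1; first by rewrite ltnS leq_add.
by econstructor; eauto.
Qed.

Lemma run_call env f a w1 w2 s t x y :
  run env a w1 x w2 s -> runf f x y t -> run env (Call f a) w1 y w2 (s + t).+1.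
Proof. by move=> ra rf; apply: run_callw ra (rf w2). Qed.

Fixpoint encN (i : nat) : tree := if i is i'.+1 then Node Leaf (encN i') else Leaf.

Fixpoint encB (B : seq bool) : tree :=
  if B is b :: B' then Node (enc_bool b) (encB B') else Leaf.

Definition enc_arc (a : darc) : tree := Node (encN a.1) (encN a.2).

Fixpoint encA (A : seq darc) : tree :=
  if A is a :: A' then Node (enc_arc a) (encA A') else Leaf.

(* Symbolic execution; the results of calls are read off [runf] hypotheses, and
   stuck case distinctions must be resolved in the context beforehand. *)
Ltac sym :=
  lazymatch goal with
  | |- run _ (Var _) _ _ _ _ => eapply run_var; cbn; reflexivity
  | |- run _ Defs.Nil _ _ _ _ => eapply run_nil
  | |- run _ (Defs.Cons _ _) _ _ _ _ => eapply run_cons; [sym | sym]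
  | |- run _ (Case _ Defs.Nil (Var 0)) _ _ _ _ => eapply run_left; [sym | cbn; reflexivity]
  | |- run _ (Case _ Defs.Nil (Var 1)) _ _ _ _ => eapply run_right; [sym | cbn; reflexivity]
  | |- run _ (Case _ _ _) _ _ _ _ => eapply run_case; [sym | cbn; sym]
  | |- run _ (Let _ _) _ _ _ _ => eapply run_let; [sym | sym]
  | |- run _ (Call _ _) _ _ _ _ => 
      first [ eapply run_call; [sym | eassumption]
            | eapply run_callw; [sym | eassumption] ]
  | |- run _ Flip _ _ _ _ => eapply run_flip
  | |- _ => idtac
  end.

Ltac exec :=
  try (match goal with |- runf _ _ _ _ => let w := fresh "w" in move=> w end);
  match goal with |- run _ (body prog ?f) _ _ _ _ =>
    let b := eval compute in (body prog f) in change (body prog f) with b;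
    eapply run_conv; [sym | try reflexivity | idtac]
  end.

(** Past the end of [B] the projections keep returning [Leaf], in agreement with the default [false]
    of [has_bit]. The cost constants, here and below, are upper bounds only. *)
Lemma run_get B u : runf GET (Node (encB B) (encN u)) (enc_bool (has_bit B u)) (u.+1 * 40).
Proof.
elim: u B => [|u IH] B.
  by case: B => [|b B]; exec; lia.
have IHB := IH (behead B).
have -> : has_bit B u.+1 = has_bit (behead B) u by case: B {IHB} => //=; rewrite /has_bit nth_nil.
have e : rsub (encB B) = encB (behead B) by case: B {IHB}.
rewrite -e in IHB.
by exec; lia.
Qed.

Lemma set_bitS B u : set_bit B u.+1 = head false B :: set_bit (behead B) u.
Proof. by case: B; case: u. Qed.

Lemma lsub_encB B : lsub (encB B) = enc_bool (head false B).
Proof. by case: B. Qed.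

Lemma rsub_encB B : rsub (encB B) = encB (behead B).
Proof. by case: B. Qed.

Lemma run_set B u : runf SET (Node (encB B) (encN u)) (encB (set_bit B u)) (u.+1 * 40).
Proof.
elim: u B => [|u IH] B.
  by case: B => [|b B]; exec; lia.
have := IH (behead B); rewrite -rsub_encB set_bitS => IHB.
by exec; [rewrite /= -lsub_encB | lia].
Qed.

Lemma run_eq u v : runf EQ (Node (encN u) (encN v)) (enc_bool (u == v)) (v.+1 * 40).
Proof.
elim: v u => [|v IH] [|u]; try by exec; lia.
by have IHu := IH u; exec; lia.
Qed.

Definition arcs_lt m (A : seq darc) := all (fun a => (a.1 < m) && (a.2 < m)) A.

Definition enc_found (r : option (darc * seq darc)) : tree :=
  if r is Some (a, R) then Node (enc_arc a) (encA R) else Leaf.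

Lemma run_find m A B : arcs_lt m A ->
  runf FIND (Node (encA A) (encB B)) (enc_found (find_arc A B))
       ((size A).+1 * (150 + 80 * m)).
Proof.
elim: A => [|a A IH] /=; first by move=> _; exec; lia.
case/andP=> /andP[a1 a2] /IH {}IH.
have := @run_get B a.1; have := @run_get B a.2.
case: (has_bit B a.1) => r2 r1; last case: (has_bit B a.2) r2 => r2.
- by case: (find_arc A B) IH => [[b R]|] IH; exec; lia.
- by exec; lia.
- by case: (find_arc A B) IH => [[b R]|] IH; exec; lia.
Qed.

Definition enc_aug (r : seq bool + nat * seq darc) : tree :=
  match r with
  | inl B => Node Leaf (encB B)
  | inr (x, A) => Node (enc_bool true) (Node (encN x) (encA A))
  end.

Lemma find_arc_lt m A B a R : arcs_lt m A -> find_arc A B = Some (a, R) ->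
  [/\ a.1 < m, a.2 < m, arcs_lt m R & size A = (size R).+1].
Proof.
move=> ltA E; have := find_arcP A B; rewrite E => -[_ _ p].
move: ltA; rewrite /arcs_lt (perm_all _ p) /= => /andP[/andP[-> ->] ->].
by rewrite (perm_size p).
Qed.

Lemma augment_lt m k A B s x A' : arcs_lt m A ->
  augment k A B s = inr (x, A') -> arcs_lt m A'.
Proof.
elim: k A B x A' => [|k IH] A B x A' ltA /=; case: (has_bit B s) => //; try by case=> _ <-.
case E: find_arc => [[a R]|] //; have [a1 a2 ltR _] := find_arc_lt ltA E.
case E': augment => [//|[y A1]]; have lt1 := IH _ _ _ _ ltR E'.
by case: eqP => _ [_ <-]; rewrite /= a1 a2.
Qed.

(** Each level of the search pays for one scan of at most [a] arcs; [m] bounds the node numbers and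
    thereby the cost of a bit access. *)
Lemma run_aug m a k A B s : arcs_lt m A -> s < m -> size A <= k -> k <= a ->
  runf AUG (Node (encA A) (Node (encB B) (encN s))) (enc_aug (augment k A B s))
       (k.+1 * (a.+1 * (150 + 80 * m) + 300 + 120 * m)).
Proof.
elim: k A B => [|k IH] A B ltA ltm szA ka; have rG := run_get B s;
  have rF := run_find B ltA; rewrite /=.
  have le1 : (size A).+1 * (150 + 80 * m) <= a.+1 * (150 + 80 * m).
    by rewrite leq_mul2r; apply/orP; right; lia.
  (* The nonlinear cost of a scan is generalised to an atom, which keeps the goals for [lia]
     linear. *)
  move: (a.+1 * _) le1 => F le1.
  case: A szA {ltA} rF le1 => // _ rF le1.
  by case: (has_bit B s) rG => rG; exec; lia.
have le1 : (size A).+1 * (150 + 80 * m) <= a.+1 * (150 + 80 * m).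
  by rewrite leq_mul2r; apply/orP; right; lia.
move: (a.+1 * _) le1 IH => F le1 IH.
case: (has_bit B s) rG => rG; first by exec; lia.
case E: (find_arc A B) rF => [[b R]|] rF; last by exec; lia.
have [b1 b2 ltR szR] := find_arc_lt ltA E.
have rS := run_set B b.1.
have := IH R (set_bit B b.1) ltR ltm; rewrite -ltnS -szR => /(_ szA (ltnW ka)).
case: augment => [B1|[x A1]] rA; first by exec; lia.
by have := run_eq x b.1; case: (x == b.1) => rE; exec; lia.
Qed.

Definition enc_flow (r : option (seq bool)) : tree :=
  if r is Some B then Node Leaf (encB B) else Leaf.

Definition aug_cost m a := a.+1 * (a.+1 * (150 + 80 * m) + 300 + 120 * m).

Lemma run_flow m a c A B0 s : arcs_lt m A -> s < m -> size A <= a ->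
  runf FLOW (Node (encN c) (Node (encA A) (Node (encB B0) (encN s))))
    (enc_flow (max_flow c A B0 s)) (c.+1 * (aug_cost m a + 100)).
Proof.
elim: c A => [|c IH] A ltA ltm szA /=; first by exec; lia.
have rA := run_aug B0 ltA ltm (leqnn _) szA.
have le1 : (size A).+1 * (a.+1 * (150 + 80 * m) + 300 + 120 * m) <= aug_cost m a.
  by rewrite leq_mul2r ltnS szA orbT.
move: (aug_cost m a) IH le1 => F IH le1.
case E: augment rA => [B1|[x A1]] rA; first by exec; lia.
have [_ sz1 _] := augment_success E.
have {}IH := IH A1 (augment_lt ltA E) ltm; rewrite sz1 in IH; have {}IH := IH szA.
by exec; lia.
Qed.

Lemma run_rep c a A : runf REP (Node (encN c) (Node (enc_arc a) (encA A)))
  (encA (nseq c a ++ A)) (c.+1 * 60).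
Proof. by elim: c => [|c IH]; exec; lia. Qed.

Fixpoint encL (s : seq nat) : tree :=
  if s is i :: s' then Node (encN i) (encL s') else Leaf.

Fixpoint enct (c : nat) : trie c -> tree :=
  if c is c'.+1 return trie c -> tree then fun t =>
    if t is Some (l, r) then Node (enct l) (enct r) else Leaf
  else encL.

Lemma enct_nil c : enct (trie_nil c) = Leaf.
Proof. by case: c. Qed.

Lemma run_ins c (t : trie c) D v :
  runf INS (Node (encN c) (Node (enct t) (Node (encB D) (encN v))))
    (enct (insert t D v)) (c.+1 * 80).
Proof.
elim: c t D => [|c IH] t D; first by exec; lia.
have IH1 := IH (trie_nil c) (behead D); rewrite enct_nil in IH1.
case: t => [[l r]|]; last first.
  case: D IH1 => [|[] D] IH1; exec; rewrite /= ?enct_nil //; lia.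
have IH2 := IH l (behead D); have IH3 := IH r (behead D).
by case: D IH2 IH3 {IH1} => [|[] D] IH2 IH3; exec; lia.
Qed.

Fixpoint enum_cost (K f : nat) : nat :=
  if f is f'.+1 then K + (enum_cost K f' + enum_cost K f') else K.

(** The complete binary recursion tree of depth [f] has [2 ^ f.+1 - 1] nodes. *)
Lemma enum_cost_le K f : enum_cost K f <= 2 ^ f.+1 * K.
Proof.
suff : enum_cost K f + K = 2 ^ f.+1 * K by move<-; apply: leq_addr.
by elim: f => [|f IH] /=; [lia | rewrite expnS -mulnA -IH; lia].
Qed.

Definition node_cost m a c z :=
  c.+1 * (aug_cost m a + 100) + a.+1 * (150 + 80 * m) + 40 * m + c.+1 * 60 +
  z.+1 * 80 + 1000.

(** Each level adds at most [c] arcs, so [size A + f * c] does not increase along the recursion and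
    [a] bounds every arc list met. *)
Lemma run_enum m a z f c A B0 s D (t : trie z) v :
  arcs_lt m A -> s < m -> size A + f * c <= a ->
  runf ENUM (Node (encN f) (Node (encA A) (Node (encB D) (Node (enct t)
         (Node (encN c) (Node (encB B0) (Node (encN s) (Node (encN z) (encN v)))))))))
    (enct (foldl (fun t D => insert t D v) t (enum_cuts f c A B0 s D)))
    (enum_cost (node_cost m a c z) f).
Proof.
elim: f A D t => [|f IH] A D t ltA ltm szA; rewrite /= /node_cost;
  have szA' : size A <= a by lia.
  have rF := run_flow c B0 ltA ltm szA'.
  case: max_flow rF => [B|] rF; last by exec; lia.
  have rN := run_find B ltA; have rI := run_ins t D v.
  have le1 : (size A).+1 * (150 + 80 * m) <= a.+1 * (150 + 80 * m).
    by rewrite leq_mul2r ltnS szA' orbT.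
  by case: find_arc rN => [[b R]|] rN; exec; lia.
have rF := run_flow c B0 ltA ltm szA'.
case: max_flow rF => [B|] rF; last by exec; lia.
have rN := run_find B ltA; have rI := run_ins t D v.
have le1 : (size A).+1 * (150 + 80 * m) <= a.+1 * (150 + 80 * m).
  by rewrite leq_mul2r ltnS szA' orbT.
case E: find_arc rN => [[b R]|] rN; last by exec; lia.
have [b1 b2 ltR szR] := find_arc_lt ltA E.
have rS := run_set D b.1; have rR := run_rep c (s, b.2) A.
have r1 := IH R (set_bit D b.1) t ltR ltm _.
have ltA' : arcs_lt m (nseq c (s, b.2) ++ A).
  by rewrite /arcs_lt all_cat all_nseq /= ltm b2 orbT.
rewrite foldl_cat; move: (foldl _ t _) r1 => t1 r1.
have r2 := IH _ D t1 ltA' ltm _.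
have {}r1 := r1 ltac:(lia).
have {}r2 := r2 ltac:(rewrite size_cat size_nseq; lia).
move: r1 r2; rewrite /node_cost; move: (enum_cost _ _) => F r1 r2.
by exec; lia.
Qed.

Lemma run_addall S s Z : all (fun i => i < S) s ->
  runf ADDALL (Node (encL s) (encB Z)) (encB (add_all s Z))
    ((size s).+1 * (60 + 40 * S)).
Proof.
elim: s Z => [|v s IH] Z /=; first by move=> _; exec; lia.
case/andP => vS /(IH (set_bit Z v)) {}IH; have rS := run_set Z v.
by exec; lia.
Qed.

Fixpoint sample_cost (S c : nat) : trie c -> nat :=
  if c is c'.+1 return trie c -> nat then fun t =>
    if t is Some (l, r) then 100 + (sample_cost S l + sample_cost S r) else 100
  else fun s => 100 + (size s).+1 * (60 + 40 * S).

Lemma run_sample S c (t : trie c) Z w :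
  (forall s, s \in payloads t -> all (fun i => i < S) s) ->
  size (payloads t) <= size w ->
  run [:: Node (encN c) (Node (enct t) (encB Z))] (body prog SAMPLE) w
    (encB (sample (payloads t) w Z)) (drop (size (payloads t)) w) (sample_cost S t).
Proof.
elim: c t Z w => [|c IH].
  case=> [|v s] Z w hS; first by move=> _; rewrite drop0; exec; rewrite /=; lia.
  case: w => // b w _.
  rewrite -[sample _ _ _]/(if b then add_all (v :: s) Z else Z).
  rewrite -[drop _ _]/(drop 0 w) drop0.
  have rA := run_addall Z (hS _ (mem_head _ _)).
  by case: b; exec; rewrite /=; lia.
case=> [[l r]|] Z w hS; last by move=> _; rewrite drop0; exec.
rewrite [payloads _]/= size_cat => szw.
have hl s : s \in payloads l -> all (fun i => i < S) s.
  by move=> sl; apply: hS; rewrite /= mem_cat sl.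
have hr s : s \in payloads r -> all (fun i => i < S) s.
  by move=> sl; apply: hS; rewrite /= mem_cat sl orbT.
have r1 := IH l Z w hl ltac:(lia).
have r2 := IH r (sample (payloads l) w Z) (drop (size (payloads l)) w) hr _.
rewrite sample_cat addnC -drop_drop.
have {}r2 := r2 ltac:(rewrite size_drop; lia).
exec; rewrite /=; lia.
Qed.

Lemma run_add u v : runf ADD (Node (encN u) (encN v)) (encN (u + v)) (u.+1 * 40).
Proof. by elim: u => [|u IH]; exec; lia. Qed.

Lemma run_min u v : runf MIN (Node (encN u) (encN v)) (encN (minn u v)) (u.+1 * 40).
Proof.
elim: u v => [|u IH] [|v]; try by exec; lia.
by have := IH v; rewrite minnSS => IHv; exec; lia.
Qed.

Definition bits_val (K : seq bool) : nat := foldr (fun (b : bool) x => b + x.*2) 0 K.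

(** Capping after every bit gives the same result as capping once, since [minn n (b + 2 * x) = minn
    n (b + 2 * minn n x)], and it keeps the unary intermediate values at most [2 * n + 1]. *)
Lemma run_cap K n : runf CAP (Node (encB K) (encN n)) (encN (minn n (bits_val K)))
  ((size K).+1 * (n.+1 * 80 + 150)).
Proof.
elim: K => [|b K IH]; first by rewrite minn0; exec; lia.
set u := minn n (bits_val K) in IH.
have rA := run_add u u; have rM := run_min n (b + (u + u)).
have -> : minn n (bits_val (b :: K)) = minn n (b + (u + u)) by rewrite /= /u; lia.
have leu : u <= n by rewrite /u; lia.
by move: rM; case: b => rM; exec; rewrite /=; lia.
Qed.

Lemma run_row r u y c A :
  runf ROW (Node (encB r) (Node (encN u) (Node (encN y) (Node (encN c) (encA A)))))
    (encA (row_arcs r u y c A)) ((size r).+1 * (c.+1 * 60 + 150)).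
Proof.
elim: r y => [|b r IH] y; first by exec; lia.
have r1 := IH y.+1; have r2 := run_rep c (u, y) (row_arcs r u y.+1 c A).
by case: b; exec; rewrite /=; lia.
Qed.

Fixpoint encM (M : seq (seq bool)) : tree :=
  if M is r :: M' then Node (encB r) (encM M') else Leaf.

Lemma run_rows n M u c A : all (fun r => size r == n) M ->
  runf ROWS (Node (encM M) (Node (encN u) (Node (encN c) (encA A))))
    (encA (edge_arcs M u c A)) ((size M).+1 * (n.+1 * (c.+1 * 60 + 150) + 150)).
Proof.
elim: M u => [|r M IH] u /=; first by move=> _; exec; lia.
case/andP=> /eqP sr /IH{}IH; have r1 := IH u.+1.
have r2 := run_row r u 0 c (edge_arcs M u.+1 c A); rewrite sr in r2.
move: (n.+1 * _) r1 r2 => F r1 r2.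
by exec; lia.
Qed.

Lemma run_vert V x u c :
  runf VERT (Node (encB V) (Node (encN x) (Node (encN u) (encN c))))
    (encA (vertex_arcs V x u c)) ((size V).+1 * (c.+1 * 60 + 150)).
Proof.
elim: V x u => [|b V IH] x u; first by exec; lia.
have r1 := IH x.+1 u.+1; have r2 := run_rep c (x, u) (vertex_arcs V x.+1 u.+1 c).
by case: b; exec; rewrite /=; lia.
Qed.

Lemma run_loop n a f c A B0 Tb v (t : trie n) :
  arcs_lt (n + n) A -> size A + f * c <= a -> v + size Tb <= n ->
  runf LOOP (Node (encB Tb) (Node (encN v) (Node (encN (n + v)) (Node (enct t)
        (Node (encN f) (Node (encA A) (Node (encN c) (Node (encB B0) (encN n)))))))))
    (enct (collect (fun v => enum_cuts f c A B0 (n + v) [::]) Tb v t))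
    ((size Tb).+1 * (enum_cost (node_cost (n + n) a c n) f + 300)).
Proof.
move=> ltA szA; elim: Tb v t => [|b Tb IH] v t; first by move=> _; exec; lia.
rewrite [size _]/= => le.
have ltm : n + v < n + n by lia.
have r1 := run_enum B0 [::] t v ltA ltm szA.
set t' := foldl _ t _ in r1.
have r2 := IH v.+1 t ltac:(lia); have r3 := IH v.+1 t' ltac:(lia).
rewrite addnS in r2 r3.
move: (enum_cost _ _) r1 r2 r3 => F r1 r2 r3.
by case: b; exec; lia.
Qed.

Lemma run_zeros B : runf ZEROS (encB B) (encN (size B)) ((size B).+1 * 40).
Proof. by elim: B => [|b B IH]; exec; rewrite /=; lia. Qed.

(** * Running time *)

(** An insertion changes a single path of the trie, adding at most one empty sibling per level, and
    lengthens one leaf list by one. *)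
Lemma sample_cost_insert S c (t : trie c) D v :
  sample_cost S (insert t D v) <= sample_cost S t + c.+1 * (320 + 80 * S).
Proof.
have le0 c' : sample_cost S (trie_nil c') <= 160 + 40 * S by case: c' => [|c'] /=; lia.
elim: c t D => [|c IH] t D /=; first lia.
have IH0 := IH (trie_nil c) (behead D); have l0 := le0 c.
case: t => [[l r]|]; case: (head false D) => /=.
- by have := IH r (behead D); lia.
- by have := IH l (behead D); lia.
- by lia.
- by lia.
Qed.

Lemma sample_cost_collect S c G N Tb v (t : trie c) :
  (forall i, size (G i) <= N) ->
  sample_cost S (collect G Tb v t) <=
  sample_cost S t + size Tb * (N * (c.+1 * (320 + 80 * S))).
Proof.
move=> leN; move F : (c.+1 * _) => K.
have fold s v' (t' : trie c) : sample_cost S (foldl (fun t D => insert t D v') t' s)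
    <= sample_cost S t' + size s * K.
  elim: s t' => [|D s IH] t' /=; first by rewrite addn0.
  by apply: leq_trans (IH _) _; have := sample_cost_insert S t' D v'; rewrite F; lia.
elim: Tb v t => [|b Tb IH] v t /=; first by rewrite addn0.
apply: leq_trans (IH _ _) _; rewrite mulSn addnA leq_add2r.
case: b; first exact: leq_addr.
by apply: leq_trans (fold _ _ _) _; rewrite leq_add2l leq_mul2r leN orbT.
Qed.

Lemma size_network n (e : rel 'I_n) Vinf c : 0 < c ->
  size (network e Vinf c) <= n * (n * c) + n * c.
Proof.
move=> c0; rewrite -(count_predT (network _ _ _)) count_network.
have le_sum (F : 'I_n -> nat) b : (forall x, F x <= b) -> \sum_(x < n) F x <= n * b.
  by move=> leF; rewrite -[X in X * b]card_ord -sum_nat_const; apply: leq_sum => x _.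
apply: leq_add; apply: (le_sum) => x; last by case: ifP => _ /=; lia.
by apply: (le_sum) => y; case: (e x y) => /=; lia.
Qed.

Lemma arcs_lt_network n (e : rel 'I_n) Vinf c : arcs_lt (n + n) (network e Vinf c).
Proof.
apply/allP => a /mem_network [[x [y [_ ->]]]|[x ->]] /=.
  by have := ltn_ord x; have := ltn_ord y; lia.
by have := ltn_ord x; lia.
Qed.

Lemma enc_setE n (A : {set 'I_n}) : enc_set A = encB (bits A).
Proof. by rewrite /enc_set /bits; elim: (enum _) => //= i s <-. Qed.

Lemma enc_relE n (e : rel 'I_n) : enc_rel e = encM (rel_bits e).
Proof.
suff gen (s s' : seq 'I_n) :
    enc_seq [seq enc_seq [seq enc_bool (e i j) | j <- s'] | i <- s] =
    encM [seq [seq e i j | j <- s'] | i <- s] by apply: gen.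
elim: s => //= i s <-; congr Node.
by elim: s' {s} => //= j s' <-.
Qed.

Definition nat_bits (k : nat) : seq bool :=
  [seq odd (k %/ 2 ^ i) | i <- iota 0 (up_log 2 k.+1)].

Lemma enc_natE k : enc_nat k = encB (nat_bits k).
Proof. by rewrite /enc_nat /nat_bits; elim: (iota _ _) => //= i s <-. Qed.

Lemma bits_val_nat_bits k : bits_val (nat_bits k) = k.
Proof.
have gen l k' : k' < 2 ^ l -> bits_val [seq odd (k' %/ 2 ^ i) | i <- iota 0 l] = k'.
  elim: l k' => [|l IH] k' /=; first by case: k'.
  rewrite expnS => lt; rewrite expn0 divn1 (iotaDl 1 0) -map_comp.
  rewrite (eq_map (g := fun i => odd (k'./2 %/ 2 ^ i))) ?IH ?odd_double_half //; first by lia.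
  by move=> i /=; rewrite add1n expnS divnMA divn2.
by apply: gen; have := @up_logP 2 k.+1 isT; lia.
Qed.

Lemma encN_nseq n : encN n = encB (nseq n false).
Proof. by elim: n => //= n ->. Qed.

(** The first two terms bound the network with [c = (n + n).+1]; the last one allows for [c] forcing
    arcs on each of up to [n + n] levels. *)
Definition arc_bound n := n * (n * (n + n).+1) + n * (n + n).+1 + (n + n) * (n + n).+1.

Definition main_cost n l f S : nat :=
  l.+1 * (n.+1 * 80 + 150) + (n.+1 * 40 + n.+1 * 40 + n.+1 * 40 +
  n.+1 * ((n + n).+2 * 60 + 150) +
  n.+1 * (n.+1 * ((n + n).+2 * 60 + 150) + 150) +
  n.+1 * (enum_cost (node_cost (n + n) (arc_bound n) (n + n).+1 n) f + 300) +
  S + 2000).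

Lemma run_main n (e : rel 'I_n) (Vinf T : {set 'I_n}) k w :
  size (payloads (candidate_trie e Vinf T k)) <= size w ->
  exists w', run [:: enc_input e Vinf T k] (body prog MAIN) w
    (enc_set (random_set e Vinf T k w)) w'
    (main_cost n (size (nat_bits k)) (minn k n + minn k n)
       (sample_cost n (candidate_trie e Vinf T k))).
Proof.
move=> szw; exists (drop (size (payloads (candidate_trie e Vinf T k))) w).
rewrite [enc_set (random_set _ _ _ _ _)]enc_setE bits_random_set.
have -> : enc_input e Vinf T k = Node (encM (rel_bits e)) (Node (encB (bits Vinf))
    (Node (encB (bits T)) (Node (encB (nat_bits k)) Leaf))).
  by rewrite /enc_input enc_relE !enc_setE enc_natE.
have rZ := run_zeros (bits T); rewrite size_bits in rZ.
have rA := run_add n n.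
have rC := run_cap (nat_bits k) n; rewrite bits_val_nat_bits minnC in rC.
have rA' := run_add (minn k n) (minn k n).
have rV := run_vert (bits Vinf) 0 n (n + n).+1; rewrite size_bits in rV.
have allM : all (fun r => size r == n) (rel_bits e).
  by apply/allP => r /mapP[i _ ->]; rewrite size_map size_enum_ord.
have rR := run_rows n (n + n).+1 (vertex_arcs (bits Vinf) 0 n (n + n).+1) allM.
rewrite [size (rel_bits e)]size_map size_enum_ord in rR.
have szA : size (network e Vinf (n + n).+1) + (minn k n + minn k n) * (n + n).+1 <= arc_bound n.
  rewrite /arc_bound leq_add //; first exact: size_network.
  by rewrite leq_mul2r; apply/orP; right; lia.
have rL := @run_loop n _ _ _ _ (bits T) (bits T) 0 (trie_nil n)
  (arcs_lt_network e Vinf (n + n).+1) szA.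
rewrite size_bits addn0 enct_nil in rL; have {}rL := rL (leqnn n).
have rS := run_sample (nseq n false) (@payloads_lt n e Vinf T k) szw.
rewrite -encN_nseq in rS.
rewrite -/(random_bits e Vinf T k w) in rS.
have lem : minn k n <= n by lia.
rewrite /main_cost; move: (enum_cost _ _) rL => F rL.
move: (l in l.+1 * _) rC => l rC.
exec.
lia.
Qed.

Lemma tree_size_encB B : size B < tree_size (encB B).
Proof. by elim: B => //= b B IH; lia. Qed.

Lemma tree_size_enc_input n (e : rel 'I_n) (Vinf T : {set 'I_n}) k :
  let N := tree_size (enc_input e Vinf T k) in
  [/\ 9 <= N, n < N & size (nat_bits k) < N].
Proof.
rewrite /enc_input /= enc_setE !enc_natE enc_setE.
have := tree_size_encB (bits Vinf); have := tree_size_encB (bits T).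
have := tree_size_encB (nat_bits k); rewrite !size_bits.
have : 0 < tree_size (enc_rel e) by case: (enc_rel e).
by split; lia.
Qed.

(** * Bounding polynomials by powers of the input size *)

Section PowerBounds.
Variables (N : nat) (N9 : 9 <= N).

(** As [N] is at least 9, constants and sums are absorbed by raising the exponent, so a polynomial
    is bounded by one power of [N] following its syntax. *)
Lemma pow_bound_const i x : x <= 9 ^ i -> x <= N ^ i.
Proof. by move=> le; apply: leq_trans le _; case: i => [|i] //; rewrite leq_exp2r. Qed.

Lemma pow_bound_add i j x y : x <= N ^ i -> y <= N ^ j -> x + y <= N ^ (maxn i j).+1.
Proof.
have N0 : 0 < N by apply: leq_trans N9.
move=> lx ly; rewrite expnS; apply: (@leq_trans (2 * N ^ maxn i j)).
  by rewrite mul2n -addnn leq_add //; [apply: leq_trans lx _ | apply: leq_trans ly _];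
    rewrite leq_pexp2l // ?leq_maxl ?leq_maxr.
by rewrite leq_mul2r; apply/orP; right; apply: leq_trans N9.
Qed.

Lemma pow_bound_mul i j x y : x <= N ^ i -> y <= N ^ j -> x * y <= N ^ (i + j).
Proof. by move=> lx ly; rewrite expnD leq_mul. Qed.

Lemma pow_bound_succ i x : x <= N ^ i -> x.+1 <= N ^ i.+1.
Proof.
move=> lx; have N0 : 0 < N ^ i by rewrite expn_gt0; apply/orP; left; apply: leq_trans N9.
by rewrite expnS; apply: (@leq_trans (9 * N ^ i)); [lia | rewrite leq_mul2r N9 orbT].
Qed.

End PowerBounds.

Ltac pow_bound :=
  lazymatch goal with
  | |- is_true (?x + ?y <= _) => eapply pow_bound_add; [eassumption | pow_bound | pow_bound]
  | |- is_true (?x * ?y <= _) => eapply pow_bound_mul; [pow_bound | pow_bound]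
  | |- is_true (_ ^ _ <= _) => apply: leqnn
  | |- is_true (2000 <= _) => apply: (@pow_bound_const _ _ 4); [eassumption | by []]
  | |- is_true (1000 <= _) => apply: (@pow_bound_const _ _ 4); [eassumption | by []]
  | |- _ => first [ eassumption
                  | apply: (@pow_bound_const _ _ 3); [eassumption | by []]
                  | eapply pow_bound_succ; [eassumption | pow_bound] ]
  end.

Lemma node_cost_bound N n : 9 <= N -> n < N ->
  node_cost (n + n) (arc_bound n) (n + n).+1 n <= N ^ 60.
Proof.
move=> N9 lt; have n1 : n <= N ^ 1 by rewrite expn1 ltnW.
rewrite /node_cost /aug_cost /arc_bound.
(* The exponent is left open and determined by [pow_bound]; 60 only has to exceed it. *)
apply: leq_trans (_ : _ <= N ^ _) _; [pow_bound | ].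
by rewrite leq_pexp2l //; apply: leq_trans N9.
Qed.

Lemma main_cost_bound N n (e : rel 'I_n) (Vinf T : {set 'I_n}) k l :
  9 <= N -> n < N -> l < N ->
  main_cost n l (minn k n + minn k n) (sample_cost n (candidate_trie e Vinf T k)) <=
  N ^ 80 * 4 ^ k.
Proof.
move=> N9 ltn ltl; set f := minn k n + minn k n; rewrite mulnC.
have E0 : 0 < 4 ^ k by rewrite expn_gt0.
have leE : 2 ^ f <= 4 ^ k.
  by rewrite -[4]/(2 ^ 2) -expnM leq_exp2l // /f; lia.
have le1 : enum_cost (node_cost (n + n) (arc_bound n) (n + n).+1 n) f <= 4 ^ k * (2 * N ^ 60).
  apply: leq_trans (enum_cost_le _ _) _; rewrite expnSr -mulnA.
  by rewrite !leq_mul // node_cost_bound.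
have le2 : sample_cost n (candidate_trie e Vinf T k) <=
    4 ^ k * (160 + 40 * n + n * (n.+1 * (320 + 80 * n))).
  apply: leq_trans (sample_cost_collect n _ _ _ (fun i => size_enum_cuts _ _ _ _ _ _)) _.
  rewrite size_bits (mulnDr (4 ^ k)) leq_add //; last by rewrite [X in _ <= X]mulnCA leq_mul2l leq_mul2r leE !orbT.
  apply: leq_trans (leq_pmull _ E0).
  by case: (n) => [|n'] /=; lia.
(* Only the enumeration and the sampling carry the factor [4 ^ k]; the other terms are enlarged by
   it so that it can be pulled out. *)
have gen A B p q r F F' S S' : F <= 4 ^ k * F' -> S <= 4 ^ k * S' ->
    A + (B + p * (F + q) + S + r) <= 4 ^ k * (A + (B + p * (F' + q) + S' + r)).
  move=> leF leS; rewrite !(mulnDr (4 ^ k)) !leq_add ?leq_pmull //.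
  by rewrite mulnCA leq_mul2l mulnDr leq_add ?leq_pmull ?orbT.
rewrite /main_cost -/f.
apply: (@leq_trans (4 ^ k * (l.+1 * (n.+1 * 80 + 150) + (n.+1 * 40 + n.+1 * 40 + n.+1 * 40 +
  n.+1 * ((n + n).+2 * 60 + 150) + n.+1 * (n.+1 * ((n + n).+2 * 60 + 150) + 150) +
  n.+1 * (2 * N ^ 60 + 300) + (160 + 40 * n + n * (n.+1 * (320 + 80 * n))) + 2000)))).
  exact: gen.
rewrite leq_mul2l; apply/orP; right.
have n1 : n <= N ^ 1 by rewrite expn1 ltnW.
have l1 : l <= N ^ 1 by rewrite expn1 ltnW.
apply: leq_trans (_ : _ <= N ^ _) _; [pow_bound | ].
by rewrite leq_pexp2l //; apply: leq_trans N9.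
Qed.

Theorem theorem5 :
  exists (P : program) (C d : nat) (f : nat -> nat),
    is_O_linear f /\
    forall (n : nat) (e : rel 'I_n) (Vinf T : {set 'I_n}) (k : nat),
      let x := enc_input e Vinf T k in
      let m := Ostar_4k C d (tree_size x) k in
      exists Z : m.-tuple bool -> {set 'I_n},
        (forall w : m.-tuple bool,
           outputs_within P x w m (enc_set (Z w)) /\ Z w \subset ~: T) /\
        (forall W Y : {set 'I_n},
           W \subset ~: (T :|: Vinf) ->
           thin e Vinf T W ->
           #|W| <= k ->
           (forall v, v \in Y ->
              exists2 W' : {set 'I_n},
                W' \subset W & important_separator e Vinf [set v] T W') ->
           (2^-1 ^+ (2 ^ f k)
            <= tape_prob [set w | (W :&: Z w == set0) && (Y \subset Z w)])%R).
Proof.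
(* The exponent [3 * k + 1] comes from [random_set_prob] and is at most [4 * k] as soon as
   [1 <= k]. *)
exists prog, 1, 80, (fun k => (3 * k).+1); split; first by exists 4, 1 => k; lia.
move=> n e Vinf T k x m.
have [N9 ltn ltl] := tree_size_enc_input e Vinf T k.
(* The tape must hold one bit per trie leaf, because [Flip] has no evaluation on an exhausted
   supply. *)
have leL : size (payloads (candidate_trie e Vinf T k)) <= m.
  apply: leq_trans (size_payloads_candidate_trie e Vinf T k) _.
  rewrite /m /Ostar_4k mul1n leq_mul2r; apply/orP; right.
  apply: leq_trans (ltnW ltn) _; rewrite -[X in X <= _]expn1 leq_pexp2l //.
exists (fun w => random_set e Vinf T k w); split=> [w|W Y].
  have leLw : size (payloads (candidate_trie e Vinf T k)) <= size w by rewrite size_tuple.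
  split; last exact: random_set_sub.
  have [w' [t let_ ev]] := run_main leLw.
  exists t, w'; split=> //; apply: leq_trans let_ _.
  by rewrite /m /Ostar_4k mul1n; apply: main_cost_bound.
exact: random_set_prob.
Qed.
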